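(* Let $Q$ be a quiver without oriented $2$-cycles and $(Q,S)$ a QP such that $S$ belongs to the path algebra $R\langle A\rangle$ and the two-sided ideal $J_0$ of $R\langle A\rangle$ generated by all cyclic derivatives $\partial_aS$ ($a\in Q_1$) contains some power of the ideal generated by the arrows. Let $\mathcal{M}=(M,V)$ and $\mathcal{N}=(N,W)$ be QP-representations of $(Q,S)$. Then the vector space $\mathcal{E}^{\rm proj}(\mathcal{M},\mathcal{N})$ (defined in the context) satisfies $$\dim\mathcal{E}^{\rm proj}(\mathcal{M},\mathcal{N})=E^{\rm proj}(\mathcal{M},\mathcal{N})=\dim\mathrm{Hom}_Q(M,N)+\sum_{k\in Q_0}g_k(\mathcal{M}^\star)\,\dim N(k).$$
   Context: **Setting.** Vector spaces are over $\mathbb{C}$. $Q=(Q_0,Q_1,h,t)$ is a finite quiver without loops; an arrow $a$ goes from its tail $t(a)$ to its head $h(a)$. $R=\bigoplus_{i\in Q_0}\mathbb{C}e_i$ with $e_ie_j=\delta_{ij}e_i$; $A$ is the $R$-bimodule with basis $Q_1$, $e_iAe_j$ spanned by arrows $j\to i$; $R\langle A\rangle$ is the path algebra (paths written right to left). The potential $S\in R\langle A\rangle$ is a finite linear combination of cyclic paths of positive length (up to cyclic rotation); $\partial_a(a_1\cdots a_d)=\sum_{p:a_p=a}a_{p+1}\cdots a_da_1\cdots a_{p-1}$. Under the assumption in the claim the Jacobian algebra $\mathcal{P}(Q,S)$ (the quotient of the complete path algebra by the closure of the ideal generated by all $\partial_aS$) is identified with the finite-dimensional algebra $R\langle A\rangle/J_0$.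 For arrows $a,b$ with $h(a)=t(b)$, $\partial_{ba}S$ is obtained by cyclically rotating the paths in $S$ so that none has first letter $a_1=a$, and setting $\partial_{ba}(a_1\cdots a_d)=\sum_{\nu:a_{\nu-1}=b,a_\nu=a}a_{\nu+1}\cdots a_da_1\cdots a_{\nu-2}$. **QP-representations.** $\mathcal{M}=(M,V)$ with $M$ a finite-dimensional $\mathcal{P}(Q,S)$-module (spaces $M(i)$, maps $a_M:M(t(a))\to M(h(a))$) and $V=(V(i))_{i\in Q_0}$ a family of finite-dimensional spaces (an $R$-module). $M_{\rm in}(k)=\bigoplus_{h(a)=k}M(t(a))$, $M_{\rm out}(k)=\bigoplus_{t(b)=k}M(h(b))$; $\alpha_k:M_{\rm in}(k)\to M(k)$ has components $a_M$, and $\gamma_k:M_{\rm out}(k)\to M_{\rm in}(k)$ has components $(\partial_{ba}S)_M:M(h(b))\to M(t(a))$; one has $\alpha_k\gamma_k=0$. $g_k(\mathcal{M})=\dim\ker\gamma_k-\dim M(k)+\dim V(k)$. The opposite QP $(Q^{\rm op},S^{\rm op})$ is obtained by reversing all arrows and all paths in $S$; $\mathcal{M}^\star=(M^\star,V)$ is the QP-representation of $(Q^{\rm op},S^{\rm op})$ with $M^\star(k)=M(k)^\star$ and the reversed arrow of $a$ acting as $(a_M)^\star$. $\mathrm{Hom}_Q$ denotes homomorphisms of quiver representations. $E^{\rm proj}(\mathcal{M},\mathcal{N})$ is defined by the right-hand expression in the claim. **The space $\mathcal{E}^{\rm proj}$.** $P_k=\bigoplus_{i\in Q_0}e_i\mathcal{P}(Q,S)e_k$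 is the indecomposable projective module at $k$. Let $\varphi:\bigoplus_kP_k\otimes M_{\rm in}(k)\to\bigoplus_kP_k\otimes M(k)$ be the module homomorphism with $$\varphi(p\otimes m)=\sum_{h(a)=k}pa\otimes\mathrm{pr}_{t(a)}m-p\otimes\alpha_k(m)\qquad(p\in P_k,\ m\in M_{\rm in}(k)),$$ where $\mathrm{pr}_{t(a)}$ is the projection of $M_{\rm in}(k)$ to the summand $M(t(a))$ corresponding to $a$. Choose subspaces $U'_k,U''_k\subseteq M_{\rm in}(k)$ and $M^{(0)}(k)\subseteq M(k)$ with $\ker\alpha_k=\mathrm{im}\,\gamma_k\oplus U'_k$, $M_{\rm in}(k)=\ker\alpha_k\oplus U''_k$, $M(k)=M^{(0)}(k)\oplus\mathrm{im}\,\alpha_k$, and put $P'=\bigoplus_kP_k\otimes\ker\alpha_k$, $P''=\bigoplus_kP_k\otimes U''_k$, $P^{(1)}=\bigoplus_kP_k\otimes U'_k\subseteq P'$, $P^{(0)}=\bigoplus_kP_k\otimes M^{(0)}(k)$. For every $p'\in P'$ there is a unique $p''\in P''$ with $\varphi(p'-p'')\in P^{(0)}$, and $\overline\varphi(p')=\varphi(p'-p'')$ defines a $\mathcal{P}(Q,S)$-module homomorphism $\overline\varphi:P'\to P^{(0)}$; restrict it to $P^{(1)}$. Let $\mathcal{E}^{\rm proj}(M,N)$ be the cokernel of the induced map $\overline\varphi^\star:\mathrm{Hom}_{\mathcal{P}(Q,S)}(P^{(0)},N)\to\mathrm{Hom}_{\mathcal{P}(Q,S)}(P^{(1)},N)$,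 and put $$\mathcal{E}^{\rm proj}(\mathcal{M},\mathcal{N})=\mathcal{E}^{\rm proj}(M,N)\oplus\mathrm{Hom}_R(V,N).$$ *)

(* Defs.v *)
From HB Require Import structures.
From mathcomp Require Import all_boot all_order all_algebra.
From mathcomp Require Import finmap.
From mathcomp Require Import boolp classical_sets functions reals.
From mathcomp Require Import complex monalg.

Set Implicit Arguments.
Unset Strict Implicit.
Unset Printing Implicit Defensive.

Import GRing.Theory.
Local Open Scope classical_set_scope.
Local Open Scope ring_scope.
Local Open Scope quotient_scope.

Section Dimension.
Variables (K : fieldType) (X : lmodType K).

Definition has_dim (n : nat) : Prop :=
  exists f : {linear X -> 'rV[K]_n}, bijective f.

Definition findim : Prop := exists n, has_dim n.

(* Meaningful for finite-dimensional [X] only; 0 otherwise. *)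
Definition vdim : nat := xget 0%N [set n | has_dim n].

End Dimension.

Definition is_direct_sum (K : fieldType) (V : vectType K) (A B C : {vspace V}) :=
  (A + B)%VS = C /\ (A :&: B)%VS = 0%VS.

Section LmodQuotient.
Variables (K : fieldType) (V : lmodType K) (I : submodClosed V).

Fact submodClosed_zmod : zmod_closed I.
Proof. by split=> [|x y hx hy]; rewrite ?rpred0 // -scaleN1r rpredD ?rpredZ. Qed.

Definition zmod_of_submod : zmodClosed V :=
  HB.pack (I : {pred V}) (GRing.isZmodClosed.Build V (I : {pred V}) submodClosed_zmod).

Definition lquot : Type := Quotient.quot zmod_of_submod.

HB.instance Definition _ := Quotient.on lquot.
HB.instance Definition _ := GRing.Zmodule.on lquot.

Definition lquot_scale (c : K) (x : lquot) : lquot :=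
  \pi_lquot (c *: repr x).

Lemma lquot_scale_pi c (v : V) :
  lquot_scale c (\pi_lquot v) = \pi_lquot (c *: v).
Proof.
apply/eqP; rewrite /lquot_scale -Quotient.idealrBE -scalerBr rpredZ //.
by rewrite -[_ \in _]/(_ \in zmod_of_submod) Quotient.idealrBE reprK.
Qed.

Lemma lquot_pi_add (v w : V) : \pi_lquot (v + w) = \pi_lquot v + \pi_lquot w.
Proof. exact: (raddfD (\pi_(Quotient.quot zmod_of_submod))). Qed.

Fact lquot_scaleA a b x :
  lquot_scale a (lquot_scale b x) = lquot_scale (a * b) x.
Proof.
rewrite -[x]reprK (lquot_scale_pi b) (lquot_scale_pi a) (lquot_scale_pi (a * b)).
by rewrite scalerA.
Qed.

Fact lquot_scale1 : left_id 1 lquot_scale.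
Proof. by move=> x; rewrite -[x]reprK (lquot_scale_pi 1) scale1r. Qed.

Fact lquot_scaleDr : right_distributive lquot_scale +%R.
Proof.
move=> a x y; rewrite -[x]reprK -[y]reprK -lquot_pi_add.
by rewrite (lquot_scale_pi a (_ + _)) !(lquot_scale_pi a (repr _)) scalerDr
  lquot_pi_add.
Qed.

Fact lquot_scaleDl v : {morph lquot_scale^~ v : a b / a + b}.
Proof.
move=> a b; rewrite -[v]reprK (lquot_scale_pi (a + b)) (lquot_scale_pi a).
by rewrite (lquot_scale_pi b) scalerDl lquot_pi_add.
Qed.

HB.instance Definition _ := GRing.Zmodule_isLmodule.Build K lquot
  lquot_scaleA lquot_scale1 lquot_scaleDr lquot_scaleDl.

End LmodQuotient.

Section DirectSum.
Variables (K : fieldType) (I : finType) (V : I -> lmodType K).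

Definition dsum : Type := forall i, V i.

HB.instance Definition _ := gen_eqMixin dsum.
HB.instance Definition _ := gen_choiceMixin dsum.

Let add (x y : dsum) : dsum := fun i => x i + y i.
Let opp (x : dsum) : dsum := fun i => - x i.
Let zero : dsum := fun=> 0.
Let scale (c : K) (x : dsum) : dsum := fun i => c *: x i.

Fact dsum_addA : associative add.
Proof. by move=> x y z; apply: functional_extensionality_dep => i; apply: addrA. Qed.
Fact dsum_addC : commutative add.
Proof. by move=> x y; apply: functional_extensionality_dep => i; apply: addrC. Qed.
Fact dsum_add0 : left_id zero add.
Proof. by move=> x; apply: functional_extensionality_dep => i; apply: add0r. Qed.
Fact dsum_addN : left_inverse zero opp add.
Proof. by move=> x; apply: functional_extensionality_dep => i; apply: addNr. Qed.

HB.instance Definition _ :=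
  GRing.isZmodule.Build dsum dsum_addA dsum_addC dsum_add0 dsum_addN.

Fact dsum_scaleA a b x : scale a (scale b x) = scale (a * b) x.
Proof. by apply: functional_extensionality_dep => i; apply: scalerA. Qed.
Fact dsum_scale1 : left_id 1 scale.
Proof. by move=> x; apply: functional_extensionality_dep => i; apply: scale1r. Qed.
Fact dsum_scaleDr : right_distributive scale +%R.
Proof. by move=> a x y; apply: functional_extensionality_dep => i; apply: scalerDr. Qed.
Fact dsum_scaleDl x : {morph scale^~ x : a b / a + b}.
Proof. by move=> a b; apply: functional_extensionality_dep => i; apply: scalerDl. Qed.

HB.instance Definition _ := GRing.Zmodule_isLmodule.Build K dsum
  dsum_scaleA dsum_scale1 dsum_scaleDr dsum_scaleDl.

Definition dsum_in (i : I) (v : V i) : dsum :=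
  @dfwith I V (fun j => 0 : V j) i v.

End DirectSum.

Section DirectSumVect.
Variables (K : fieldType) (I : finType) (V : I -> vectType K).

Definition dvsum : Type := dsum (fun i => V i : lmodType K).

HB.instance Definition _ := GRing.Lmodule.on dvsum.

Fact dvsum_vect_iso :
  Vector.axiom #|{: {i : I & 'I_(\dim {:V i})}}| dvsum.
Proof.
pose T := {i : I & 'I_(\dim {:V i})}.
pose f (x : dvsum) : 'rV[K]_#|{: T}| := \row_j
  coord (vbasis {:V (tag (enum_val j))}) (tagged (enum_val j))
        (x (tag (enum_val j))).
pose g (r : 'rV[K]_#|{: T}|) : dvsum := fun i =>
  \sum_(m < \dim {:V i}) r 0 (enum_rank (Tagged (fun i => 'I_(\dim {:V i})) m : T))
     *: (vbasis {:V i})`_m.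
exists f.
  by move=> c x y; apply/rowP => j; rewrite !mxE linearP.
exists g => [x|r].
  apply: functional_extensionality_dep => i.
  rewrite [RHS](coord_vbasis (memvf (x i))); apply: eq_bigr => m _.
  by rewrite /f mxE enum_rankK.
apply/rowP => j; rewrite mxE; case: (enum_val j) (enum_valK j) => i m /= <-.
rewrite /g linear_sum (bigD1 m) //= linearZ /=.
rewrite (coord_free m m (basis_free (vbasisP _))) eqxx mulr1 big1 ?addr0 //.
move=> m' ne; rewrite linearZ /=.
by rewrite (coord_free m' m (basis_free (vbasisP _))) (negbTE ne) mulr0.
Qed.

HB.instance Definition _ := Lmodule_hasFinDim.Build K dvsum dvsum_vect_iso.

Definition dvsum_in (i : I) : 'Hom(V i, dvsum) :=
  linfun (fun v : V i => @dsum_in K I (fun j => V j : lmodType K) i v : dvsum).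
Definition dvsum_pr (i : I) : 'Hom(dvsum, V i) := linfun (fun x : dvsum => x i).

End DirectSumVect.

Section Tensor.
Variable K : fieldType.

(* [P (x) U] in coordinates: [K^n] is identified with [U] via [vbasis], and
   [P (x) K^n] with [P^n]. *)
Definition tensor (P : lmodType K) (U : vectType K) : lmodType K :=
  {ffun 'I_(\dim {:U}) -> P}.

Definition ptensor (P : lmodType K) (U : vectType K) (p : P) (u : U) :
    tensor P U :=
  [ffun m => coord (vbasis {:U}) m u *: p].

(* [f (x) g]; the definition is used for linear [f] *)
Definition tensor_map (P P' : lmodType K) (U U' : vectType K)
    (f : P -> P') (g : 'Hom(U, U')) (x : tensor P U) : tensor P' U' :=
  \sum_(m < \dim {:U}) ptensor (f (x m)) (g (vbasis {:U})`_m).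

End Tensor.

(* [arr i j] is the set of arrows with tail [i] and head [j]. *)
Record quiver := Quiver { vert :> finType; arr : vert -> vert -> finType }.
Arguments arr : clear implicits.
Arguments arr {q}.

Definition loopless (Q : quiver) : Prop := forall i : Q, arr i i -> False.
Definition no_2cycles (Q : quiver) : Prop :=
  forall i j : Q, arr i j -> arr j i -> False.

(* Paths from [j] to [i]. Paths are written right to left: [PCons a p] is the
   word [a p], i.e. the path [p] followed by the arrow [a]. *)
Inductive qpath (Q : quiver) (j : Q) : Q -> Type :=
| PNil : qpath j j
| PCons (l i : Q) (a : arr l i) (p : qpath j l) : qpath j i.
Arguments PNil {Q} j.
Arguments PCons {Q j l i} a p.

Section Paths.
Variable Q : quiver.
Implicit Types i j k l s t : Q.

HB.instance Definition _ j i := gen_eqMixin (qpath j i).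
HB.instance Definition _ j i := gen_choiceMixin (qpath j i).

Fixpoint plen j i (p : qpath j i) : nat :=
  if p is PCons _ _ _ p' then (plen p').+1 else 0%N.

Definition parrow i j (a : arr i j) : qpath i j := PCons a (PNil i).

(* the concatenated word [p q] *)
Fixpoint pcat j k i (p : qpath k i) (q : qpath j k) {struct p} : qpath j i :=
  match p in qpath _ i0 return qpath j i0 with
  | PNil => q
  | PCons _ _ a p' => PCons a (pcat p' q)
  end.

(* If [b = a], the unique factorization of the word [b p] as [u a v] with
   [u] trivial, given as [(v, u)]. *)
Definition here s t (a : arr s t) j l i (b : arr l i) (p : qpath j l) :
    seq (qpath j s * qpath t i) :=
  match l =P s, i =P t with
  | ReflectT e, ReflectT f =>
      if ecast x (arr x t) e (ecast y (arr l y) f b) == a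
      then [:: (ecast x (qpath j x) e p, ecast y (qpath y i) f (PNil i))]
      else [::]
  | _, _ => [::]
  end.

(* The list of all [(v, u)] such that [p] is the word [u a v]: one entry for
   each occurrence of the letter [a] in [p]. *)
Fixpoint occ s t (a : arr s t) j i (p : qpath j i) {struct p} :
    seq (qpath j s * qpath t i) :=
  match p in qpath _ i0 return seq (qpath j s * qpath t i0) with
  | PNil => [::]
  | PCons l i0 b p' =>
      here a b p' ++ [seq (x.1, PCons b x.2) | x <- occ a p']
  end.

Definition cycle_path : Type := {i : Q & qpath i i}.
HB.instance Definition _ := gen_eqMixin cycle_path.
HB.instance Definition _ := gen_choiceMixin cycle_path.

Definition mkcycle i (p : qpath i i) : cycle_path := existT _ i p.

(* The cyclic path [c], rotated by one letter if its first (leftmost) letter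
   is [a]. When [Q] has no loops the result never starts with [a]. *)
Definition rotate_off s t (a : arr s t) (c : cycle_path) : cycle_path :=
  if [seq x <- occ a (tagged c) | plen x.2 == 0%N] is x :: _
  then mkcycle (pcat x.1 (pcat x.2 (parrow a))) else c.

End Paths.

Section PathAlgebra.
Variables (K : fieldType) (Q : quiver).
Implicit Types i j k l : Q.

(* [PA j i] is [e_i R<A> e_j]; the path algebra [R<A>] is the direct sum of
   these spaces. Its elements, subsets and two-sided ideals are handled through
   their components: an ideal [I] is the direct sum of the [e_i I e_j]. *)
Definition PA j i : lmodType K := {malg K[qpath j i]}.

Definition pmul j k i (x : PA k i) (y : PA j k) : PA j i :=
  \sum_(p <- msupp x) \sum_(q <- msupp y) << x@_p * y@_q *g pcat p q >>.

Lemma msupp_sumEw (T : choiceType) (V : lmodType K) (F : T -> V)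
    (g : {malg K[T]}) (d : {fset T}) : (msupp g `<=` d)%fset ->
  \sum_(k <- msupp g) g@_k *: F k = \sum_(k <- d) g@_k *: F k.
Proof.
move=> le; apply: big_fset_incl => // k _ /mcoeff_outdom ->.
by rewrite scale0r.
Qed.

Lemma msupp_sum_linear (T : choiceType) (V : lmodType K) (F : T -> V) :
  linear (fun g : {malg K[T]} => \sum_(k <- msupp g) g@_k *: F k).
Proof.
move=> c x y; pose d := (msupp x `|` msupp y)%fset.
rewrite (@msupp_sumEw _ _ F (c *: x + y) d); last first.
  apply: fsubset_trans (msuppD_le _ _) _.
  by apply: fsetSU; apply: msuppZ_le.
rewrite (@msupp_sumEw _ _ F x d) ?fsubsetUl // (@msupp_sumEw _ _ F y d) ?fsubsetUr //.
rewrite scaler_sumr -big_split; apply: eq_bigr => k _ /=.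
by rewrite mcoeffD mcoeffZ scalerDl scalerA.
Qed.

Lemma pmul_linear_r j k i (x : PA k i) : linear (fun y : PA j k => pmul x y).
Proof.
pose F q : PA j i := \sum_(p <- msupp x) << x@_p *g pcat p q >>.
have E y : pmul x y = \sum_(q <- msupp y) y@_q *: F q.
  rewrite /pmul exchange_big; apply: eq_bigr => q _; rewrite scaler_sumr.
  apply: eq_bigr => p _; apply/malgP => r.
  by rewrite mcoeffZ !mcoeffU mulrnAr mulrC.
by move=> c y z; rewrite !E; apply: (@msupp_sum_linear _ _ F).
Qed.

Record is_ideal (I : forall j i, set (PA j i)) : Prop := IsIdeal {
  ideal0 : forall j i, I j i 0;
  idealD : forall j i x y, I j i x -> I j i y -> I j i (x + y);
  idealZ : forall j i c x, I j i x -> I j i (c *: x);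
  idealMl : forall j k i (x : PA k i) (y : PA j k), I j k y -> I j i (pmul x y);
  idealMr : forall j k i (x : PA k i) (y : PA j k), I k i x -> I j i (pmul x y)
}.

Definition ideal_gen (X : forall j i, set (PA j i)) j i : set (PA j i) :=
  [set x | forall I, is_ideal I -> (forall j i, X j i `<=` I j i) -> I j i x].

Definition ideal_mul (I J : forall j i, set (PA j i)) :
    forall j i, set (PA j i) :=
  ideal_gen (fun j i =>
    [set z | exists k (x : PA k i) (y : PA j k),
               [/\ I k i x, J j k y & z = pmul x y]]).

Fixpoint ideal_exp (I : forall j i, set (PA j i)) (n : nat) :
    forall j i, set (PA j i) :=
  if n is n'.+1 then ideal_mul I (ideal_exp I n') else fun j i => setT.

Definition arrow_ideal : forall j i, set (PA j i) :=
  ideal_gen (fun j i => [set << parrow a >> | a in [set: arr j i]]).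

Lemma ideal_gen_ideal X : is_ideal (ideal_gen X).
Proof.
split=> [j i I hI _|j i x y hx hy I hI hX|j i c x hx I hI hX
        |j k i x y hy I hI hX|j k i x y hx I hI hX].
- exact: ideal0.
- by apply: idealD => //; [apply: hx | apply: hy].
- by apply: idealZ => //; apply: hx.
- by apply: idealMl => //; apply: hy.
- by apply: idealMr => //; apply: hx.
Qed.

(* An element of the sum of the [e_i R<A> e_i]. *)
Definition potential : Type := {malg K[cycle_path Q]}.

Definition is_potential (S : potential) : Prop :=
  forall c, c \in msupp S -> (0 < plen (tagged c))%N.

Definition cyc_deriv (S : potential) i j (a : arr i j) : PA j i :=
  \sum_(c <- msupp S) S@_c *:
    \sum_(x <- occ a (tagged c)) (<< pcat x.1 x.2 >> : PA j i).

(* [cyc_deriv2 S b a] is the element written d_{ba} S, for [h(a) = t(b)]: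
   the sum over the factorizations [u b a v] of the rotated paths of [S]. *)
Definition cyc_deriv2 (S : potential) j k i (b : arr k i) (a : arr j k) :
    PA i j :=
  \sum_(c <- msupp S) S@_c *:
    \sum_(x <- occ a (tagged (rotate_off a c)))
      \sum_(y <- occ b x.2 | plen y.1 == 0%N) (<< pcat x.1 y.2 >> : PA i j).

(* The ideal J_0. *)
Definition jacobian_ideal (S : potential) : forall j i, set (PA j i) :=
  ideal_gen (fun j i => [set cyc_deriv S a | a in [set: arr i j]]).

Section JacobianAlgebra.
Variables (S : potential) (j i : Q).

Definition jacobian_pred : {pred PA j i} :=
  fun x => `[< jacobian_ideal S x >].

Fact jacobian_pred_closed : subsemimod_closed jacobian_pred.
Proof.
have hI := ideal_gen_ideal (fun j i => [set cyc_deriv S a | a in [set: arr i j]]).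
split; first split; first by apply/asboolP; apply: ideal0 hI _ _.
  by move=> x y /asboolP hx /asboolP hy; apply/asboolP; apply: idealD hI _ _ _ _ hx hy.
by move=> c x /asboolP hx; apply/asboolP; apply: idealZ hI _ _ _ _ hx.
Qed.

HB.instance Definition _ :=
  GRing.isSubmodClosed.Build K (PA j i) jacobian_pred jacobian_pred_closed.

(* [e_i P(Q,S) e_j], where P(Q,S) = R<A> / J_0 *)
Definition jacobian : lmodType K := lquot jacobian_pred.

Definition jac_class (x : PA j i) : jacobian := \pi_(lquot jacobian_pred) x.
Definition jac_repr (x : jacobian) : PA j i := repr (x : lquot jacobian_pred).

Lemma jac_reprK x : jac_class (jac_repr x) = x.
Proof. exact: (@reprK _ (lquot jacobian_pred)). Qed.

Lemma jac_class_linear : linear jac_class.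
Proof.
move=> c x y; rewrite /jac_class lquot_pi_add; congr (_ + _).
by rewrite -[RHS]/(lquot_scale c _) lquot_scale_pi.
Qed.

Lemma jac_class_eq x y :
  jac_class x = jac_class y <-> jacobian_ideal S (x - y).
Proof.
have E := @Quotient.idealrBE _ (zmod_of_submod jacobian_pred) x y.
by split=> [/eqP h|h]; [apply/asboolP; rewrite -E in h | apply/eqP; rewrite -[_ == _]E; apply/asboolP].
Qed.

End JacobianAlgebra.

End PathAlgebra.

Section Representations.
Variables (K : fieldType) (Q : quiver).
Implicit Types i j k l : Q.

Record rep := Rep {
  rep_sp :> Q -> lmodType K;
  rep_map : forall i j, arr i j -> {linear rep_sp i -> rep_sp j}
}.

Record fdrep := FdRep {
  fd_sp :> Q -> vectType K;
  fd_map : forall i j, arr i j -> 'Hom(fd_sp i, fd_sp j)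
}.

Definition rep_of_fd (M : fdrep) : rep :=
  @Rep (fun i => M i : lmodType K)
       (fun i j a => fd_map M a : {linear M i -> M j}).

Section Hom.
Variables M N : rep.

Definition hom_pred :
    {pred dsum (fun i => (M i -> N i) : lmodType K)} :=
  fun f => `[< (forall i, linear (f i)) /\
               (forall i j (a : arr i j) x,
                  f j (rep_map M a x) = rep_map N a (f i x)) >].

Fact hom_pred_closed : subsemimod_closed hom_pred.
Proof.
split; first split.
- apply/asboolP; split=> [i c x y|i j a x]; first by rewrite scaler0 addr0.
  by rewrite linear0.
- move=> f g /asboolP[lf cf] /asboolP[lg cg]; apply/asboolP.
  have E i x : (f + g) i x = f i x + g i x by [].
  split=> [i c x y|i j a x]; first by rewrite !E lf lg scalerDr addrACA.
  by rewrite !E cf cg linearD.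
- move=> c f /asboolP[lf cf]; apply/asboolP.
  have E i x : (c *: f) i x = c *: f i x by [].
  split=> [i b x y|i j a x]; first by rewrite !E lf scalerDr !scalerA mulrC.
  by rewrite !E cf linearZ.
Qed.

HB.instance Definition _ := GRing.isSubmodClosed.Build K _ hom_pred hom_pred_closed.

Record repHom : Type := RepHom { hom_val; hom_valP : hom_val \in hom_pred }.

HB.instance Definition _ := [isSub for hom_val].
HB.instance Definition _ := [Choice of repHom by <:].
HB.instance Definition _ := [SubChoice_isSubLmodule of repHom by <:].

End Hom.

Section Action.
Variable M : fdrep.

Fixpoint path_act j i (p : qpath j i) : 'Hom(M j, M i) :=
  match p in qpath _ i0 return 'Hom(M j, M i0) with
  | PNil => \1%VF
  | PCons _ _ a p' => (fd_map M a \o path_act p')%VF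
  end.

Definition act j i (x : PA K j i) : 'Hom(M j, M i) :=
  \sum_(p <- msupp x) x@_p *: path_act p.

(* A finite-dimensional module over R<A> / J_0 is a representation annihilated
   by J_0. *)
Definition is_jacobian_module (S : potential K Q) : Prop :=
  forall j i (x : PA K j i), jacobian_ideal S x -> act x = 0.

Definition M_in k : vectType K :=
  dvsum (fun x : {l : Q & arr l k} => M (tag x)).
Definition M_out k : vectType K :=
  dvsum (fun x : {i : Q & arr k i} => M (tag x)).

Definition alpha k : 'Hom(M_in k, M k) :=
  \sum_(a : {l : Q & arr l k}) (fd_map M (tagged a) \o dvsum_pr _ a)%VF.

Definition gamma (S : potential K Q) k : 'Hom(M_out k, M_in k) :=
  \sum_(a : {l : Q & arr l k}) \sum_(b : {i : Q & arr k i})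
    (dvsum_in _ a \o act (cyc_deriv2 S (tagged b) (tagged a)) \o dvsum_pr _ b)%VF.

End Action.

(* A pair (M, V); see [is_QPrep] for the condition on M. *)
Record decrep := DecRep { dec_rep : fdrep; dec_sp : Q -> vectType K }.

Definition is_QPrep (S : potential K Q) (M : decrep) : Prop :=
  is_jacobian_module (dec_rep M) S.

Definition g_vec (S : potential K Q) (M : decrep) k : int :=
  (\dim (lker (gamma (dec_rep M) S k)))%:Z - (\dim {:dec_rep M k})%:Z
  + (\dim {:dec_sp M k})%:Z.

End Representations.

Coercion rep_of_fd : fdrep >-> rep.

Section Opposite.
Variables (K : fieldType) (Q : quiver).

Definition op_quiver : quiver := @Quiver (vert Q) (fun i j => arr j i).

Fixpoint prev (j i : Q) (p : qpath j i) : @qpath op_quiver i j :=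
  match p in qpath _ i0 return @qpath op_quiver i0 j with
  | PNil => @PNil op_quiver j
  | PCons l i0 a p' => pcat (prev p') (@parrow op_quiver i0 l a)
  end.

Definition op_potential (S : potential K Q) : potential K op_quiver :=
  \sum_(c <- msupp S) << S@_c *g mkcycle (prev (tagged c)) >>.

Definition dual_rep (M : fdrep K Q) : fdrep K op_quiver :=
  @FdRep K op_quiver (fun i => 'Hom(M i, K^o) : vectType K)
    (fun i j (a : @arr op_quiver i j) =>
       linfun (fun f : 'Hom(M i, K^o) => (f \o fd_map M (a : @arr Q j i))%VF)).

Definition dual_decrep (M : decrep K Q) : decrep K op_quiver :=
  @DecRep K op_quiver (dual_rep (dec_rep M)) (dec_sp M).

End Opposite.

Section Projectives.
Variables (K : fieldType) (Q : quiver) (S : potential K Q).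
Implicit Types i j k l : Q.

(* [P k i] is [P_k(i) = e_i P(Q,S) e_k]. *)
Local Notation P k i := (jacobian S k i).

(* left multiplication [x |-> a x] and right multiplication [x |-> x a] *)
Definition jac_lmul k i j (a : arr i j) (x : P k i) : P k j :=
  jac_class S (pmul << parrow a >> (jac_repr x)).
Definition jac_rmul l k i (a : arr l k) (x : P k i) : P l i :=
  jac_class S (pmul (jac_repr x) << parrow a >>).

Fact jac_lmul_linear k i j (a : arr i j) : linear (@jac_lmul k i j a).
Proof.
move=> c x y; rewrite /jac_lmul -jac_class_linear -pmul_linear_r.
have : jacobian_ideal S (jac_repr (c *: x + y) - (c *: jac_repr x + jac_repr y)).
  by apply/jac_class_eq; rewrite jac_class_linear !jac_reprK.
move=> /(idealMl (ideal_gen_ideal _) << parrow a >>) h; apply/jac_class_eq.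
by rewrite addrC -scaleN1r -pmul_linear_r scaleN1r addrC.
Qed.

(* The module [(+)_k P_k (x) U_k]. *)
Definition proj_sp (U : Q -> vectType K) i : lmodType K :=
  dsum (fun k => tensor (P k i) (U k)).

Definition proj_act (U : Q -> vectType K) i j (a : arr i j)
    (x : proj_sp U i) : proj_sp U j :=
  fun k => [ffun m => jac_lmul a (x k m)].

Fact proj_act_linear U i j (a : arr i j) : linear (@proj_act U i j a).
Proof.
move=> c x y; apply: functional_extensionality_dep => k; apply/ffunP => m.
by rewrite !ffunE -jac_lmul_linear; congr jac_lmul; rewrite !ffunE.
Qed.

HB.instance Definition _ U i j (a : arr i j) :=
  GRing.isLinear.Build K _ _ _ (@proj_act U i j a) (@proj_act_linear U i j a).

Definition proj (U : Q -> vectType K) : rep K Q :=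
  @Rep K Q (proj_sp U) (fun i j a => @proj_act U i j a).

(* The homomorphism with components [id (x) g_k]. *)
Definition proj_map (U U' : Q -> vectType K) (g : forall k, 'Hom(U k, U' k))
    i (x : proj U i) : proj U' i :=
  fun k => tensor_map (fun p : P k i => p) (g k) (x k).

Definition sub_fam (U : Q -> vectType K) (W : forall k, {vspace (U k)}) :
    Q -> vectType K := fun k => subvs_of (W k).

Definition proj_incl (U : Q -> vectType K) (W : forall k, {vspace (U k)}) i :
    proj (sub_fam W) i -> proj U i :=
  proj_map (fun k => linfun (vsval : subvs_of (W k) -> U k)) (i := i).

Section Ecal.
Variable M : fdrep K Q.

Definition phi i (x : proj (M_in M) i) : proj M i :=
  \sum_(k : Q)
    ((\sum_(a : {l : Q & arr l k})
        dsum_in (tensor_map (jac_rmul (tagged a)) (dvsum_pr _ a) (x k)))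
     - dsum_in (tensor_map (fun p : P k i => p) (alpha M k) (x k))).

(* [U1 k], [U2 k], [M0 k] stand for U'_k, U''_k and M^(0)(k). *)
Record splitting := Splitting {
  U1 : forall k, {vspace (M_in M k)};
  U2 : forall k, {vspace (M_in M k)};
  M0 : forall k, {vspace (M k)};
  U1P : forall k, is_direct_sum (limg (gamma M S k)) (U1 k) (lker (alpha M k));
  U2P : forall k, is_direct_sum (lker (alpha M k)) (U2 k) fullv;
  M0P : forall k, is_direct_sum (M0 k) (limg (alpha M k)) fullv
}.

Variable spl : splitting.

Definition ker_alpha k : {vspace (M_in M k)} := lker (alpha M k).

Definition Pprime : rep K Q := proj (sub_fam ker_alpha).
Definition Psecond : rep K Q := proj (sub_fam (U2 spl)).
Definition P1 : rep K Q := proj (sub_fam (U1 spl)).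
Definition P0 : rep K Q := proj (sub_fam (M0 spl)).

(* The inclusion of P^(1) into P'. *)
Definition P1_incl i : P1 i -> Pprime i :=
  proj_map (fun k => linfun (fun u : subvs_of (U1 spl k) =>
                               vsproj (ker_alpha k) (vsval u))) (i := i).

(* [phibar x] is the element [phi (x - y)] of P^(0), where [y] in P'' is the
   unique element for which [phi (x - y)] is in P^(0). *)
Definition phibar i (x : Pprime i) : P0 i :=
  xget 0 [set z | exists y : Psecond i,
                    phi (proj_incl x - proj_incl y) = proj_incl z].

Section Coker.
Variable N : rep K Q.

(* The image of [psi |-> psi \o phibar] from Hom(P^(0), N) to Hom(P^(1), N). *)
Definition phibar_star_im : {pred repHom P1 N} :=
  fun h => `[< exists psi : repHom P0 N, forall i (x : P1 i),
                 hom_val h x = hom_val psi (phibar (P1_incl x)) >].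

Fact phibar_star_im_closed : subsemimod_closed phibar_star_im.
Proof.
split; first split.
- by apply/asboolP; exists 0.
- move=> f g /asboolP[f' hf] /asboolP[g' hg]; apply/asboolP; exists (f' + g').
  by move=> i x; rewrite [LHS]/(hom_val f x + hom_val g x) hf hg.
- move=> c f /asboolP[f' hf]; apply/asboolP; exists (c *: f').
  by move=> i x; rewrite [LHS]/(c *: hom_val f x) hf.
Qed.

HB.instance Definition _ :=
  GRing.isSubmodClosed.Build K _ phibar_star_im phibar_star_im_closed.

Definition Eproj_coker : lmodType K := lquot phibar_star_im.

End Coker.

End Ecal.

Definition Eproj_space (M N : decrep K Q) (spl : splitting (dec_rep M)) :
    lmodType K :=
  (Eproj_coker spl (dec_rep N) *
   dsum (fun i => 'Hom(dec_sp M i, dec_rep N i) : lmodType K))%type.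

Definition Eproj (M N : decrep K Q) : int :=
  (vdim (repHom (dec_rep M) (dec_rep N)))%:Z +
  \sum_(k : Q) g_vec (op_potential S) (dual_decrep M) k
               * (\dim {:dec_rep N k})%:Z.

End Projectives.

(* Main.v *)
(* By Yoneda, a homomorphism from (+)_k P_k (x) U_k to N is a family of linear
   maps U_k -> N(k), and composition with phi sends f to the family
   a_N f - f a_M, whose kernel is Hom_Q(M, N). Long paths act as zero, so by
   descending induction on path length every family on M^(0) extends uniquely to
   a family f on M with phi^* f = 0 on U''; thus phibar^* becomes the restriction
   of phi^* f to U', and its cokernel has dimension
   sum_k (dim U'_k - dim M^(0)(k)) dim N(k) + dim Ker. The kernel is Hom_Q(M, N):
   expanding 0 = (d_b S)_N f - f (d_b S)_M letter by letter gives
   (phi^* f) gamma = 0 up to longer paths, so phi^* f = 0 once it vanishes on U'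
   and U''. Finally gamma of the dual representation is the transpose of gamma,
   which turns dim U'_k - dim M^(0)(k) into dim ker gamma^* - dim M(k). *)
From HB Require Import structures.
Require Import Defs.
From mathcomp Require Import all_boot all_order all_algebra.
From mathcomp Require Import finmap ring.
From mathcomp Require Import boolp classical_sets reals complex monalg.
Set Implicit Arguments.
Unset Strict Implicit.
Unset Printing Implicit Defensive.
Import GRing.Theory.
Local Open Scope ring_scope.

(** The phrase up to longer paths is made exact by composing on the left with [path_act N q]. A
    claim is proved for all [q] of length at least [d], with [d] descending from [n], where every
    such [q] acts as zero, to 0, where [q] may be trivial; a term with a further arrow between [q]
    and the unknown falls under the previous case. Only uniqueness of the extension from M^(0) needs
    this induction: dim U''_k = rank alpha_k = dim M(k) - dim M^(0)(k), so the families with phi^* f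
    = 0 on U'' form a space at least as large as that of the families on M^(0), and injectivity of
    the restriction forces bijectivity. The rotations defining d_{ba} S hide that it is a quotient:
    it is what remains of d_b S after deleting a leading letter a, and equally of d_a S after
    deleting a final letter b. The first form fits the expansion of d_b S letter by letter; reversal
    of paths exchanges the two, so the passage to the dual needs both. *)

(** * Occurrences of letters in words, and second cyclic derivatives *)

Section Words.
Variable Q : quiver.
Implicit Types (i j k l s t : Q).

Lemma pcatA j k l i (p : qpath l i) (q : qpath k l) (r : qpath j k) :
  pcat (pcat p q) r = pcat p (pcat q r).
Proof. by elim: p q => //= l' i' a p IH q; rewrite IH. Qed.

Lemma pcat0 j i (p : qpath j i) : pcat p (PNil j) = p.
Proof. by elim: p => //= l i' a p ->. Qed.

Lemma plen_pcat j k i (p : qpath k i) (q : qpath j k) :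
  plen (pcat p q) = (plen p + plen q)%N.
Proof. by elim: p q => //= l i' a p IH q; rewrite IH. Qed.

Definition arrowT : Type := {x : Q * Q & arr x.1 x.2}.
Definition mkarrow i j (a : arr i j) : arrowT := existT _ (i, j) a.

(** Arrows with different endpoints are compared in the total type [arrowT]. Eliminating the
    equality there replaces [b] and both its endpoints at once, without transports along equalities
    of vertices. *)
Lemma arrow_ind s t (a : arr s t) (P : forall l i, arr l i -> Prop) :
  P s t a -> forall l i (b : arr l i), mkarrow b = mkarrow a -> P l i b.
Proof.
move=> Pa l i b e.
suff : (fun y : arrowT => P _ _ (tagged y)) (mkarrow b) by [].
by rewrite e.
Qed.

Lemma here_same s t (a : arr s t) j (p : qpath j s) :
  here a a p = [:: (p, PNil t)].
Proof.
rewrite /here; case: eqP => // e; case: eqP => // f.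
by rewrite !eq_axiomK /= eqxx.
Qed.

Lemma here_diff s t (a : arr s t) j l i (b : arr l i) (p : qpath j l) :
  mkarrow b <> mkarrow a -> here a b p = [::].
Proof.
move=> ne; rewrite /here; case: eqP => // e; case: eqP => // f.
case: eqP => // h; case: ne.
by move: h; destruct e, f => /= ->.
Qed.

Variable V : nmodType.

Lemma sum_here_same s t (a : arr s t) j (p : qpath j s)
    (F : qpath j s * qpath t t -> V) :
  \sum_(x <- here a a p) F x = F (p, PNil t).
Proof. by rewrite here_same big_seq1. Qed.

Lemma occ_cons s t (a : arr s t) j l i (b : arr l i) (p : qpath j l)
    (F : qpath j s * qpath t i -> V) :
  \sum_(x <- occ a (PCons b p)) F x =
    \sum_(x <- here a b p) F x + \sum_(x <- occ a p) F (x.1, PCons b x.2).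
Proof. by rewrite /= big_cat big_map. Qed.

Lemma occ_pcat s t (a : arr s t) j k i (p : qpath k i) (q : qpath j k)
    (F : qpath j s * qpath t i -> V) :
  \sum_(x <- occ a (pcat p q)) F x =
    \sum_(x <- occ a p) F (pcat x.1 q, x.2)
    + \sum_(x <- occ a q) F (x.1, pcat p x.2).
Proof.
elim: p q F => [|l i' b p IH] q F /=.
  by rewrite big_nil add0r; apply: eq_bigr => -[].
rewrite !occ_cons IH addrA; congr (_ + _ + _).
have [e|ne] := pselect (mkarrow b = mkarrow a); last by rewrite !here_diff ?big_nil.
move: q p F {IH}; move: l i' b e; apply: arrow_ind => q p F.
by rewrite !here_same !big_seq1.
Qed.

(** Both sides run over the factorizations p = w a v b u, choosing first the right-hand letter [b]
    or first the left-hand letter [a]. *)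
Lemma occ_occ s t (a : arr s t) (s' t' : Q) (b : arr s' t') j i (p : qpath j i)
    (G : qpath j s' -> qpath t' s -> qpath t i -> V) :
  \sum_(x <- occ b p) \sum_(y <- occ a x.2) G x.1 y.1 y.2 =
  \sum_(x <- occ a p) \sum_(y <- occ b x.1) G y.1 y.2 x.2.
Proof.
elim: p G => [|l i' c p IH] G; first by rewrite !big_nil.
rewrite !occ_cons /= -(IH (fun u v w => G u v (PCons c w))).
under [X in _ + X = _]eq_bigr do rewrite occ_cons.
rewrite big_split addrA /=; congr (_ + _).
rewrite big1_seq ?add0r; last first.
  move=> x /andP[_]; have [e|ne] := pselect (mkarrow c = mkarrow b); last by rewrite here_diff.
  move: p G x {IH}; move: l i' c e; apply: arrow_ind => p G x.
  by rewrite here_same inE => /eqP -> /=; rewrite big_nil.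
have [e|ne] := pselect (mkarrow c = mkarrow a).
  move: p G {IH}; move: l i' c e; apply: arrow_ind => p G.
  rewrite here_same big_seq1 /=; apply: eq_bigr => x _.
  by rewrite here_same big_seq1.
rewrite here_diff // big_nil big1 // => x _; by rewrite here_diff // big_nil.
Qed.

Lemma occ_lead s t (a : arr s t) j l i (b : arr l i) (p : qpath j l)
    (F : qpath j s -> V) :
  \sum_(x <- occ a (PCons b p) | plen x.2 == 0%N) F x.1 =
  \sum_(x <- here a b p) F x.1.
Proof.
rewrite big_mkcond occ_cons -big_mkcond /= [X in _ + X]big1 ?addr0 //.
have [e|ne] := pselect (mkarrow b = mkarrow a); last by rewrite !here_diff ?big_nil.
move: p F; move: l i b e; apply: arrow_ind => p F.
by rewrite here_same big_cons !big_seq1 /= big_nil addr0.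
Qed.

(* [d_{ba} S = a^{-1} d_b S = d_a S b^{-1}], one cyclic path at a time. *)
Lemma cyc_lead_trail l k i (b : arr k i) (a : arr l k) s (c : qpath s s)
    (F : qpath i l -> V) :
  \sum_(x <- occ b c) \sum_(y <- occ a (pcat x.1 x.2) | plen y.2 == 0%N) F y.1 =
  \sum_(x <- occ a c) \sum_(y <- occ b (pcat x.1 x.2) | plen y.1 == 0%N) F y.2.
Proof.
have E1 (x : qpath s k * qpath i s) :
  \sum_(y <- occ a (pcat x.1 x.2) | plen y.2 == 0%N) F y.1 =
  \sum_(y <- occ a x.1) (if plen y.2 == 0%N then F (pcat y.1 x.2) else 0)
  + \sum_(y <- occ a x.2)
      (if (plen x.1 == 0%N) && (plen y.2 == 0%N) then F y.1 else 0).
  rewrite big_mkcond occ_pcat; congr (_ + _).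
  by apply: eq_bigr => y _; rewrite plen_pcat addn_eq0.
have E2 (x : qpath s l * qpath k s) :
  \sum_(y <- occ b (pcat x.1 x.2) | plen y.1 == 0%N) F y.2 =
  \sum_(y <- occ b x.1)
      (if (plen y.1 == 0%N) && (plen x.2 == 0%N) then F y.2 else 0)
  + \sum_(y <- occ b x.2) (if plen y.1 == 0%N then F (pcat x.1 y.2) else 0).
  rewrite big_mkcond occ_pcat; congr (_ + _).
  by apply: eq_bigr => y _; rewrite plen_pcat addn_eq0.
under eq_bigr do rewrite E1; under [RHS]eq_bigr do rewrite E2.
rewrite !big_split /= addrC; congr (_ + _).
  exact: (occ_occ a b c
    (fun u v w => if (plen u == 0%N) && (plen w == 0%N) then F v else 0)).
symmetry; exact: (occ_occ b a c
    (fun u v w => if plen v == 0%N then F (pcat u w) else 0)).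
Qed.

Hypothesis nl : loopless Q.

(** Stated for independent endpoints so that it also inverts closed paths, on which direct case
    analysis is blocked by the repeated vertex. *)
Lemma qpath_cases j i (c : qpath j i) :
  (exists e : j = i, c = ecast x (qpath j x) e (PNil j)) \/
  (exists l (b : arr l i) (p : qpath j l), c = PCons b p).
Proof. by case: c => [|l i' b p]; [left; exists erefl | right; exists l, b, p]. Qed.

(** Deleting [a] from c = u a v leaves v u, whose last letter is that of u unless u is trivial.
    Moving a leading [a] to the other end removes exactly this exception, and it does not change any
    of the words v u. *)
Lemma cyc_rotate l k i (b : arr k i) (a : arr l k) (c : Defs.cycle_path Q)
    (F : qpath i l -> V) :
  \sum_(x <- occ a (tagged (rotate_off a c)))
    \sum_(y <- occ b x.2 | plen y.1 == 0%N) F (pcat x.1 y.2) =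
  \sum_(x <- occ a (tagged c))
    \sum_(y <- occ b (pcat x.1 x.2) | plen y.1 == 0%N) F y.2.
Proof.
case: c => s c /=; case: (qpath_cases c) => [[e ->]|[l0 [d [p ->]]]].
  by rewrite eq_axiomK /rotate_off /= !big_nil.
have [e|ne] := pselect (mkarrow d = mkarrow a); last first.
  have -> : rotate_off a (existT _ s (PCons d p)) = existT _ s (PCons d p).
    rewrite /rotate_off /= here_diff //=.
    by elim: (occ a p) => //= x r ->.
  rewrite !occ_cons !here_diff // !big_nil !add0r; apply: eq_bigr => x _ /=.
  rewrite [RHS]big_mkcond occ_pcat /= [X in _ = X + _]big1 ?add0r; last first.
    by move=> y _; rewrite plen_pcat /= addnS.
  by rewrite -big_mkcond.
move: p {c}; move: l0 s d e; apply: arrow_ind => p.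
have -> : rotate_off a (existT _ k (PCons a p)) = mkcycle (pcat p (parrow a)).
  by rewrite /rotate_off /= here_same.
change (tagged (existT _ k (PCons a p))) with (PCons a p).
rewrite [tagged _]/= occ_pcat addrC !occ_cons !here_same !big_seq1 /=.
rewrite big_nil addr0 pcat0.
congr (_ + _); apply: eq_bigr => x _.
rewrite [RHS]big_mkcond occ_pcat /= [X in _ = X + _]big1 ?add0r; last first.
  by move=> y _; rewrite plen_pcat /= addnS.
(* The letters differ: [a] ends where [b] starts, so their equality would give a loop. *)
rewrite occ_cons here_diff ?big_nil ?add0r; last first.
  by move=> e; have [ekl eik] := (congr1 tag e); subst l; exact: (nl a).
by rewrite [LHS]big_mkcond; apply: eq_bigr => y _; rewrite pcatA.
Qed.

Lemma cyc_deriv2_lead l k i (b : arr k i) (a : arr l k) (c : Defs.cycle_path Q)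
    (F : qpath i l -> V) :
  \sum_(x <- occ a (tagged (rotate_off a c)))
    \sum_(y <- occ b x.2 | plen y.1 == 0%N) F (pcat x.1 y.2) =
  \sum_(x <- occ b (tagged c))
    \sum_(y <- occ a (pcat x.1 x.2) | plen y.2 == 0%N) F y.1.
Proof. by rewrite cyc_lead_trail cyc_rotate. Qed.

End Words.

(** * Reversal of paths *)

Section OpWords.
Variable Q : quiver.
Implicit Types (i j k l s t : Q).
Variable V : nmodType.

Lemma plen_prev j i (p : qpath j i) : plen (Defs.prev p) = plen p.
Proof. by elim: p => //= l i' a p IH; rewrite plen_pcat IH addn1. Qed.

Lemma prev_pcat j k i (p : qpath k i) (q : qpath j k) :
  Defs.prev (pcat p q) = pcat (Defs.prev q) (Defs.prev p).
Proof. by elim: p q => [|l i' a p IH] q /=; rewrite ?pcat0 // IH pcatA. Qed.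

Lemma mkarrow_op l i s t (b : arr l i) (a : arr s t) :
  @mkarrow (op_quiver Q) i l b = @mkarrow (op_quiver Q) t s a ->
  mkarrow b = mkarrow a.
Proof.
move=> e.
suff : (fun y : arrowT (op_quiver Q) =>
   @mkarrow Q (tag y).2 (tag y).1 (tagged y) = mkarrow a) (@mkarrow (op_quiver Q) i l b) by [].
by rewrite e.
Qed.

Lemma occ_prev s t (a : arr s t) j i (p : qpath j i)
    (F : @qpath (op_quiver Q) i t * @qpath (op_quiver Q) s j -> V) :
  \sum_(x <- @occ (op_quiver Q) t s a i j (Defs.prev p)) F x =
  \sum_(x <- occ a p) F (Defs.prev x.2, Defs.prev x.1).
Proof.
elim: p F => [|l i' b p IH] F; first by rewrite !big_nil.
rewrite [Defs.prev _]/= occ_pcat addrC IH !occ_cons [X in _ + X + _]/= big_nil.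
rewrite addr0; congr (_ + _).
have [e|ne] := pselect (mkarrow b = mkarrow a).
  move: p F {IH}; move: l i' b e; apply: arrow_ind => p F.
  by rewrite !here_same !big_seq1 /= pcat0.
rewrite !here_diff ?big_nil //.
  by move/mkarrow_op.
Qed.

End OpWords.

(** * Dimensions of quotients, direct sums and annihilators *)

Section Dim.
Variable K : fieldType.

Definition linear_pack (U V : lmodType K) (f : U -> V) (fL : linear f) :
  {linear U -> V} := HB.pack f (GRing.isLinear.Build _ _ _ _ f fL).

Lemma dim_inj (U V : vectType K) (f : {linear U -> V}) :
  injective f -> (\dim {:U} <= \dim {:V})%N.
Proof.
move=> fI; have h : lker (linfun f) == 0%VS.
  by apply/lker0P => x y; rewrite !lfunE; apply: fI.
rewrite -(limg_dim_eq (f := linfun f) (U := fullv)) ?dimvS ?subvf //.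
by rewrite (eqP h) capv0.
Qed.

Lemma linear_of_cancel (X Y : lmodType K) (f : {linear X -> Y}) (g : Y -> X) :
  cancel f g -> cancel g f -> linear g.
Proof. by move=> fK gK c x y; apply: (can_inj fK); rewrite linearP !gK. Qed.

Lemma has_dim_uniq (X : lmodType K) n m : has_dim X n -> has_dim X m -> n = m.
Proof.
suff h a b : has_dim X a -> has_dim X b -> (a <= b)%N.
  by move=> hn hm; apply/eqP; rewrite eqn_leq !h.
case=> f [f' fK f'K] [g [g' gK g'K]].
pose e : 'rV[K]_a -> 'rV[K]_b := g \o f'.
have le : linear e by move=> c x y; rewrite /e /= (linear_of_cancel fK f'K) linearP.
pose E : {linear 'rV[K]_a -> 'rV[K]_b} := linear_pack le.
have EI : injective E by apply: inj_comp; [exact: can_inj gK | exact: can_inj f'K].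
by have := dim_inj EI; rewrite !dimvf /dim /= !mul1n.
Qed.

Lemma vdimE (X : lmodType K) n : has_dim X n -> vdim X = n.
Proof.
move=> h; rewrite /vdim; case: xgetP => [m _ hm|/(_ n)] //.
exact: has_dim_uniq hm h.
Qed.

(** First isomorphism theorem, with [X] a bare [lmodType]: coordinates on [X] are those of a
    preimage projected to the complement of [W]. *)
Lemma has_dim_surj (V : vectType K) (X : lmodType K) (p : {linear V -> X})
    (W : {vspace V}) :
  (forall x, exists v, p v = x) -> (forall v, (p v = 0) <-> (v \in W)) ->
  has_dim X (\dim {:V} - \dim W).
Proof.
move=> ps pW; rewrite -dimv_compl.
pose F (v : V) : 'rV[K]_(\dim W^C) :=
  \row_i coord (vbasis W^C) i (daddv_pi W^C W v).
have FL : linear F by move=> c x y; apply/rowP => i; rewrite !mxE !linearP.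
have dj : (W^C :&: W = 0)%VS by rewrite capvC capv_compl.
have FW v : F v = 0 <-> v \in W.
  have dec : v = daddv_pi W^C W v + daddv_pi W W^C v.
    by rewrite (daddv_pi_add dj) // addvC addv_complf memvf.
  split=> [h|vW].
    have -> : v = daddv_pi W W^C v.
      rewrite {1}dec [X in X + _](_ : _ = 0) ?add0r //.
      rewrite (coord_vbasis (memv_pi W^C W v)) big1 // => i _.
      by have := congr1 (fun m : 'rV_ _ => m 0 i) h; rewrite !mxE => ->; rewrite scale0r.
    exact: memv_pi.
  suff e : daddv_pi W^C W v = 0 by apply/rowP => i; rewrite !mxE e linear0.
  have : daddv_pi W^C W v \in (W^C :&: W)%VS.
    rewrite memv_cap memv_pi /= -[X in X \in _](addrK (daddv_pi W W^C v)) -dec.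
    by rewrite rpredB ?memv_pi.
  by rewrite dj memv0 => /eqP.
have Fs r : exists v, F v = r.
  exists (\sum_i r 0 i *: (vbasis W^C)`_i); apply/rowP => j; rewrite !mxE.
  rewrite daddv_pi_id //; last first.
    by apply: memv_suml => i _; rewrite memvZ // vbasis_mem // mem_nth // size_tuple.
  rewrite linear_sum (bigD1 j) //= linearZ /= coord_free ?(basis_free (vbasisP _)) //.
  rewrite eqxx mulr1 big1 ?addr0 // => i ne; rewrite linearZ /=.
  by rewrite coord_free ?(basis_free (vbasisP _)) // (negbTE ne) mulr0.
pose s x := projT1 (cid (ps x)); have sK x : p (s x) = x := projT2 (cid (ps x)).
(* [p] and [F] have the same kernel, hence the same fibres, so each factors through the other along
   chosen preimages. *)
have key x y : p x = p y <-> F x = F y.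
  have B : F (x - y) = F x - F y.
    by rewrite -scaleN1r addrC FL scaleN1r addrC.
  split=> /eqP; rewrite -subr_eq0.
    by rewrite -linearB => /eqP/pW/FW; rewrite B => /eqP; rewrite subr_eq0 => /eqP.
  by rewrite -B => /eqP/FW/pW/eqP; rewrite linearB subr_eq0 => /eqP.
pose t r := projT1 (cid (Fs r)); have tK r : F (t r) = r := projT2 (cid (Fs r)).
pose f x := F (s x).
have fL : linear f.
  move=> c x y; rewrite /f -FL; apply/key; by rewrite linearP !sK.
pose f' : {linear X -> 'rV[K]_(\dim W^C)} :=
  linear_pack fL.
exists f'; exists (p \o t) => x /=.
  by rewrite -[RHS]sK; apply/key; rewrite tK.
by rewrite /f -[RHS]tK; apply/key; rewrite sK.
Qed.

Lemma dim_Hom (U V : vectType K) : \dim {:'Hom(U, V)} = (\dim {:U} * \dim {:V})%N.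
Proof. by rewrite !dimvf. Qed.

Lemma dim_subvs (V : vectType K) (W : {vspace V}) : \dim {:subvs_of W} = \dim W.
Proof. by rewrite dimvf. Qed.

Lemma dim_dvsum (I : finType) (V : I -> vectType K) :
  \dim {:dvsum V} = (\sum_i \dim {:V i})%N.
Proof.
rewrite dimvf [LHS](_ : _ = #|{: {i : I & 'I_(\dim {:V i})}}|) //.
rewrite card_tagged sumnE big_map big_enum; apply: eq_bigr => i _.
by rewrite card_ord.
Qed.

Lemma has_dim_prod (X Y : lmodType K) n m :
  has_dim X n -> has_dim Y m -> has_dim (X * Y)%type (n + m).
Proof.
case=> f [f' fK f'K] [g [g' gK g'K]].
pose h (z : X * Y) : 'rV[K]_(n + m) := row_mx (f z.1) (g z.2).
have hL : linear h.
  by move=> c x y; rewrite /h !linearP scale_row_mx add_row_mx.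
exists (linear_pack hL : {linear _ -> _}).
exists (fun r => (f' (lsubmx r), g' (rsubmx r))) => [[x y]|r] /=.
  by rewrite /h /= row_mxKl row_mxKr fK gK.
by rewrite /h /= f'K g'K hsubmxK.
Qed.

Lemma has_dim_bij (V : vectType K) (X : lmodType K) (p : {linear V -> X}) :
  (forall x, exists v, p v = x) -> injective p -> has_dim X (\dim {:V}).
Proof.
move=> ps pI.
have -> : \dim {:V} = (\dim {:V} - \dim (0%VS : {vspace V}))%N by rewrite dimv0 subn0.
apply: has_dim_surj ps _ => v.
by rewrite memv0; split=> [|/eqP ->]; rewrite ?linear0 // -(linear0 p) => /pI ->.
Qed.

(** [W] is the kernel of restricting forms to the image of [g], and this restriction is onto because
    a form extends along a projection to that image. *)
Lemma dim_annihilator (U V : vectType K) (g : 'Hom(U, V))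
    (W : {vspace 'Hom(V, K^o)}) :
  (forall xi : 'Hom(V, K^o), xi \in W = ((xi \o g)%VF == 0)) ->
  \dim W = (\dim {:V} - \dim (limg g))%N.
Proof.
move=> hW.
pose r (xi : 'Hom(V, K^o)) : 'Hom(subvs_of (limg g), K^o) :=
  (xi \o linfun (vsval : subvs_of (limg g) -> V))%VF.
have rL : linear r by move=> c x y; rewrite /r comp_lfunDl comp_lfunZl.
pose r' := linfun (linear_pack rL
  : {linear 'Hom(V, K^o) -> 'Hom(subvs_of (limg g), K^o)}).
have -> : W = lker r'.
  apply/vspaceP => xi; rewrite hW memv_ker lfunE /=.
  apply/eqP/eqP => h; apply/lfunP => x.
    rewrite !lfunE /= !lfunE /=.
    have /memv_imgP[u _ ->] := subvsP x.
    by have := congr1 (fun f : 'Hom(_, _) => f u) h; rewrite !lfunE.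
  have := congr1 (fun f : 'Hom(_, _) => f (vsproj (limg g) (g x))) h.
  by rewrite !lfunE /= !lfunE /= vsprojK // memv_img ?memvf.
have := limg_ker_dim r' fullv; rewrite capfv.
have -> : limg r' = fullv.
  apply/vspaceP => y; rewrite memvf; apply/memv_imgP.
  exists (y \o linfun (vsproj (limg g)))%VF; rewrite ?memvf // lfunE /=.
  by apply/lfunP => x; rewrite !lfunE /= !lfunE /= lfunE /= vsvalK.
rewrite !dim_Hom dim_subvs [\dim {:K^o}]dimvf [dim _]/= !muln1 => <-.
by rewrite addnK.
Qed.
End Dim.

Section CompSum.
Variables (K : fieldType) (U V W : vectType K) (I : Type) (r : seq I) (P : pred I).

Lemma comp_lfun_suml (f : I -> 'Hom(V, W)) (g : 'Hom(U, V)) :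
  ((\sum_(i <- r | P i) f i) \o g = \sum_(i <- r | P i) (f i \o g))%VF.
Proof.
apply/lfunP => x; rewrite !lfunE /= !sum_lfunE.
by apply: eq_bigr => i _; rewrite lfunE.
Qed.

Lemma comp_lfun_sumr (f : 'Hom(V, W)) (g : I -> 'Hom(U, V)) :
  (f \o (\sum_(i <- r | P i) g i) = \sum_(i <- r | P i) (f \o g i))%VF.
Proof.
apply/lfunP => x; rewrite !lfunE /= !sum_lfunE linear_sum.
by apply: eq_bigr => i _; rewrite lfunE.
Qed.
End CompSum.

(** * The path algebra, the Jacobian algebra and their modules *)

Section PathAlgebraTheory.
Variables (K : fieldType) (Q : quiver).
Implicit Types (i j k l : Q).

Lemma malgUZ (T : choiceType) (c : K) (p : T) :
  << c *g p >> = c *: << p >> :> {malg K[T]}.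
Proof. by apply/malgP => r; rewrite mcoeffZ !mcoeffU mulrnAr mulr1. Qed.

Lemma msupp_sumU (T : choiceType) (V : lmodType K) (F : T -> V) (c : K) (p : T) :
  \sum_(k <- msupp << c *g p >>) (<< c *g p >>)@_k *: F k = c *: F p.
Proof. by rewrite (msupp_sumEw _ msuppU_le) big_seq_fset1 mcoeffUU. Qed.

Lemma malg_ind (T : choiceType) (P : {malg K[T]} -> Prop) :
  (forall x y, P x -> P y -> P (x + y)) -> (forall c x, P x -> P (c *: x)) ->
  P 0 -> (forall p, P << p >>) -> forall x, P x.
Proof.
move=> PD PZ P0 Pp x; rewrite [x]monalgE; apply: big_ind => // p _.
by rewrite malgUZ; apply: PZ.
Qed.

Lemma pmul_linear_l j k i (y : PA K j k) : linear (fun x : PA K k i => pmul x y).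
Proof.
pose F p : PA K j i := \sum_(q <- msupp y) << y@_q *g pcat p q >>.
have E x : pmul x y = \sum_(p <- msupp x) x@_p *: F p.
  rewrite /pmul; apply: eq_bigr => p _; rewrite scaler_sumr.
  by apply: eq_bigr => q _; rewrite [in RHS]malgUZ malgUZ scalerA.
by move=> c x z; rewrite !E; apply: (@msupp_sum_linear _ _ _ F).
Qed.

Lemma pmulU j k i (p : qpath k i) (q : qpath j k) :
  pmul << p >> << q >> = << pcat p q >> :> PA K j i.
Proof.
rewrite /pmul !msuppU oner_eq0 !big_seq_fset1.
by rewrite !mcoeffUU mulr1.
Qed.

Section Act.
Variable M : fdrep K Q.

Lemma act_linear j i : linear (@act K Q M j i).
Proof. exact: (@msupp_sum_linear _ _ _ (@path_act K Q M j i)). Qed.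

HB.instance Definition _ j i := GRing.isLinear.Build K _ _ _ (@act K Q M j i)
  (@act_linear j i).

Lemma actU j i (p : qpath j i) : act M << p >> = path_act M p.
Proof. by rewrite /act msupp_sumU scale1r. Qed.

Lemma path_act_pcat j k i (p : qpath k i) (q : qpath j k) :
  path_act M (pcat p q) = (path_act M p \o path_act M q)%VF.
Proof.
elim: p q => [|l i' a p IH] q /=; first by rewrite comp_lfun1l.
by rewrite IH comp_lfunA.
Qed.

Lemma act_pmul j k i (x : PA K k i) (y : PA K j k) :
  act M (pmul x y) = (act M x \o act M y)%VF.
Proof.
rewrite /pmul linear_sum [act M x]/act comp_lfun_suml; apply: eq_bigr => p _.
rewrite linear_sum [act M y]/act comp_lfun_sumr; apply: eq_bigr => q _ /=.
by rewrite malgUZ linearZ /= actU path_act_pcat -comp_lfunZl -comp_lfunZr scalerA.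
Qed.
End Act.

Section Jacobian.
Variable S : potential K Q.
Local Notation P k i := (jacobian S k i).
Local Notation J := (jacobian_ideal S).

Lemma jac_ideal : is_ideal (jacobian_ideal S).
Proof. exact: ideal_gen_ideal. Qed.

HB.instance Definition _ k i := GRing.isLinear.Build K _ _ _ (@jac_class K Q S k i)
  (@jac_class_linear K Q S k i).

Lemma jac_repr_class k i (x : PA K k i) : J (jac_repr (jac_class S x) - x).
Proof. by apply/jac_class_eq; rewrite jac_reprK. Qed.

Lemma jac_rmul_class l k i (a : arr l k) (x : PA K k i) :
  jac_rmul a (jac_class S x) = jac_class S (pmul x << parrow a >>).
Proof.
rewrite /jac_rmul; apply/jac_class_eq.
have := Defs.idealMr jac_ideal << parrow a >> (jac_repr_class x).
by rewrite addrC -scaleN1r pmul_linear_l scaleN1r addrC.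
Qed.

Lemma jac_lmul_class k i j (a : arr i j) (x : PA K k i) :
  jac_lmul a (jac_class S x) = jac_class S (pmul << parrow a >> x).
Proof.
rewrite /jac_lmul; apply/jac_class_eq.
have := Defs.idealMl jac_ideal << parrow a >> (jac_repr_class x).
by rewrite addrC -scaleN1r pmul_linear_r scaleN1r addrC.
Qed.

Lemma jac_rmul_linear l k i (a : arr l k) : linear (@jac_rmul K Q S l k i a).
Proof.
move=> c x y; rewrite -(jac_reprK x) -(jac_reprK y) -linearP.
by rewrite !jac_rmul_class pmul_linear_l linearP.
Qed.

HB.instance Definition _ l k i (a : arr l k) := GRing.isLinear.Build K _ _ _
  (@jac_rmul K Q S l k i a) (@jac_rmul_linear l k i a).
HB.instance Definition _ k i j (a : arr i j) := GRing.isLinear.Build K _ _ _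
  (@jac_lmul K Q S k i j a) (@jac_lmul_linear K Q S k i j a).

Definition jpath k i (p : qpath k i) : P k i := jac_class S << p >>.

Lemma jac_rmul_path l k i (a : arr l k) (p : qpath k i) :
  jac_rmul a (jpath p) = jpath (pcat p (parrow a)).
Proof. by rewrite jac_rmul_class pmulU. Qed.

Lemma jac_lmul_path k i j (a : arr i j) (p : qpath k i) :
  jac_lmul a (jpath p) = jpath (PCons a p).
Proof. by rewrite jac_lmul_class pmulU. Qed.

Lemma jacobian_ind k i (X : P k i -> Prop) :
  (forall x y, X x -> X y -> X (x + y)) -> (forall c x, X x -> X (c *: x)) ->
  X 0 -> (forall p, X (jpath p)) -> forall x, X x.
Proof.
move=> XD XZ X0 Xp x; rewrite -(jac_reprK x).
elim/malg_ind: (jac_repr x) => [y z|c y||p]; rewrite ?linearD ?linearZ ?linear0;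
  [exact: XD|exact: XZ|exact: X0|exact: Xp].
Qed.

Section Module.
Variable N : fdrep K Q.
Hypothesis NJ : is_jacobian_module N S.

(** Computed on the chosen representative; [jact_class] shows independence of the choice, since J_0
    acts as zero. *)
Definition jact k i (x : P k i) : 'Hom(N k, N i) := act N (jac_repr x).

Lemma jact_class k i (x : PA K k i) : jact (jac_class S x) = act N x.
Proof.
apply/eqP; rewrite -subr_eq0 -linearB; apply/eqP; apply: NJ.
exact: jac_repr_class.
Qed.

Lemma jact_linear k i : linear (@jact k i).
Proof.
move=> c x y; rewrite -(jac_reprK x) -(jac_reprK y) -linearP.
by rewrite !jact_class linearP.
Qed.

Lemma jact_path k i (p : qpath k i) : jact (jpath p) = path_act N p.
Proof. by rewrite jact_class actU. Qed.

Lemma jact_rmul l k i (a : arr l k) (x : P k i) :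
  jact (jac_rmul a x) = (jact x \o fd_map N a)%VF.
Proof. by rewrite jact_class act_pmul actU /= comp_lfun1r. Qed.

Lemma jact_lmul k i j (a : arr i j) (x : P k i) :
  jact (jac_lmul a x) = (fd_map N a \o jact x)%VF.
Proof. by rewrite jact_class act_pmul actU /= comp_lfun1r. Qed.
End Module.

Variable n : nat.
Hypothesis Sn : forall j i (x : PA K j i),
  ideal_exp (@arrow_ideal K Q) n x -> jacobian_ideal S x.

(** Arrows are split off on the left one at a time; the rest of a longer path is absorbed by the
    zeroth power, which is the whole algebra. *)
Lemma path_ideal_exp m j i (p : qpath j i) :
  (m <= plen p)%N -> ideal_exp (@arrow_ideal K Q) m (<< p >> : PA K j i).
Proof.
elim: m j i p => // m IH j i [//|l i' a p] /= hp I hI; apply.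
exists l, << parrow a >>, << p >>; split; last by rewrite pmulU.
- by move=> I' hI'; apply; exists a.
- exact: IH.
Qed.

(** Together with [path_act_eq0], the only form in which the inclusion of a power of the arrow ideal
    in J_0 is used; both serve as base cases of the descending inductions. *)
Lemma jpath_eq0 j i (p : qpath j i) : (n <= plen p)%N -> jpath p = 0.
Proof.
move=> /path_ideal_exp/Sn h; rewrite -(linear0 (@jac_class K Q S j i)).
by apply/jac_class_eq; rewrite subr0.
Qed.

Lemma path_act_eq0 (N : fdrep K Q) (NJ : is_jacobian_module N S) j i
    (p : qpath j i) : (n <= plen p)%N -> path_act N p = 0.
Proof. by move=> /path_ideal_exp/Sn/NJ; rewrite actU. Qed.

End Jacobian.
End PathAlgebraTheory.

Lemma linfunE (K : fieldType) (U V : vectType K) (f : U -> V) :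
  linear f -> linfun f =1 f.
Proof.
by move=> L u; exact: (lfunE (linear_pack L)).
Qed.

(** * Finite direct sums of vector spaces *)

Section DvsumTheory.
Variables (K : fieldType) (I : finType) (V : I -> vectType K).

Lemma dvsum_inE i (v : V i) j : dvsum_in V i v j = @dfwith I V (fun j => 0 : V j) i v j.
Proof.
have L : linear (fun v : V i => @dsum_in K I (fun j => V j : lmodType K) i v : dvsum V).
  move=> c x y; apply: functional_extensionality_dep => j'.
  rewrite [RHS]/(c *: dsum_in (V:=fun j => V j : lmodType K) x j' + dsum_in (V:=fun j => V j : lmodType K) y j').
  rewrite /dsum_in; have [<-|ne] := eqVneq i j'; first by rewrite !dfwith_in.
  rewrite !dfwith_out // scaler0; exact: esym (addr0 _).
by rewrite /dvsum_in (linfunE L).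
Qed.

Lemma dvsum_prE i (x : dvsum V) : dvsum_pr V i x = x i.
Proof.
have L : linear (fun x : dvsum V => x i) by [].
by rewrite /dvsum_pr (linfunE L).
Qed.

Lemma dvsum_ext (x y : dvsum V) : (forall i, x i = y i) -> x = y.
Proof. exact: functional_extensionality_dep. Qed.

Lemma dvsum_sumE (J : Type) (r : seq J) (P : pred J) (F : J -> dvsum V) i :
  (\sum_(j <- r | P j) F j) i = \sum_(j <- r | P j) F j i.
Proof. exact: (big_morph (fun x : dvsum V => x i)). Qed.

Lemma dvsum_decomp (x : dvsum V) : \sum_i dvsum_in V i (x i) = x.
Proof.
apply: dvsum_ext => j; rewrite dvsum_sumE (bigD1 j) //= dvsum_inE dfwith_in.
by rewrite big1 ?addr0 // => i ne; rewrite dvsum_inE dfwith_out.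
Qed.

Lemma dvsum_hom_ext (W : vectType K) (f g : 'Hom(dvsum V, W)) :
  (forall i, (f \o dvsum_in V i = g \o dvsum_in V i)%VF) -> f = g.
Proof.
move=> h; apply/lfunP => x; rewrite -(dvsum_decomp x) !linear_sum.
apply: eq_bigr => i _; have := congr1 (fun F : 'Hom(_, _) => F (x i)) (h i).
by rewrite !lfunE.
Qed.

Lemma dvsum_hom_in (W : vectType K) (f : forall i, 'Hom(V i, W)) i :
  ((\sum_j (f j \o dvsum_pr V j)) \o dvsum_in V i = f i)%VF.
Proof.
apply/lfunP => v; rewrite lfunE /= sum_lfunE (bigD1 i) //= lfunE /= dvsum_prE.
rewrite dvsum_inE dfwith_in big1 ?addr0 // => j ne.
by rewrite lfunE /= dvsum_prE dvsum_inE dfwith_out 1?eq_sym // linear0.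
Qed.

End DvsumTheory.

(** * Families of linear maps, composition with phi, and expansion along paths *)

Section HomSpace.
Variables (K : fieldType) (Q : quiver) (S : potential K Q) (M N : fdrep K Q).
Implicit Types (i j k l s : Q).

(** A [vectType] model of the homomorphisms from (+)_k P_k (x) U_k to N, on which dimensions can be
    counted; [hatHom] is the identification. *)
Definition hsp (U : Q -> vectType K) : vectType K := dvsum (fun k => 'Hom(U k, N k)).

Definition defect (f : hsp M) l k (a : arr l k) : 'Hom(M l, N k) :=
  ((fd_map N a \o f l) - (f k \o fd_map M a))%VF.

(* Composition with [phi], read through [hatHom]. *)
Definition phistar (f : hsp M) : hsp (M_in M) := fun k =>
  \sum_(a : {l : Q & arr l k}) (defect f (tagged a) \o dvsum_pr _ a)%VF.

Lemma phistarE (f : hsp M) k u :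
  phistar f k u =
    \sum_(a : {l : Q & arr l k}) fd_map N (tagged a) (f (tag a) (u a))
    - f k (alpha M k u).
Proof.
rewrite /phistar /alpha !sum_lfunE linear_sum -sumrB; apply: eq_bigr => a _.
by rewrite !lfunE /= dvsum_prE !lfunE /= !lfunE /= comp_lfunE.
Qed.

Lemma phistar_in (f : hsp M) k (a : {l : Q & arr l k}) :
  (phistar f k \o dvsum_in _ a)%VF = defect f (tagged a).
Proof. exact: (@dvsum_hom_in K _ (fun a : {l : Q & arr l k} => M (tag a))). Qed.

Lemma phistar_linear : linear phistar.
Proof.
move=> c f g; apply: dvsum_ext => k; apply/lfunP => u.
rewrite [(c *: phistar f + phistar g) k]/(c *: phistar f k + phistar g k).
rewrite !lfunE /= lfunE /= !phistarE scalerBr addrACA -opprD; congr (_ - _).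
  rewrite scaler_sumr -big_split; apply: eq_bigr => a _ /=.
  by rewrite [(c *: f + g) _]/(c *: f (tag a) + g (tag a)) lfunE /= lfunE /= linearP.
by rewrite [(c *: f + g) _]/(c *: f k + g k) lfunE /= lfunE /=.
Qed.

HB.instance Definition _ := GRing.isLinear.Build K _ _ _ phistar phistar_linear.

(* The sum of [N(x) (defect f a) M(y)] over the factorizations [w = x a y]. *)
Fixpoint der (f : hsp M) j i (w : qpath j i) : 'Hom(M j, N i) :=
  match w in qpath _ i0 return 'Hom(M j, N i0) with
  | PNil => 0
  | PCons _ _ a p =>
      ((defect f a \o path_act M p) + (fd_map N a \o der f p))%VF
  end.

Lemma derE (f : hsp M) j i (w : qpath j i) :
  der f w = ((path_act N w \o f j) - (f i \o path_act M w))%VF.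
Proof.
elim: w => [|l i' a p IH] /=; first by rewrite comp_lfun1l comp_lfun1r subrr.
rewrite IH /defect comp_lfunDl comp_lfunDr comp_lfunNl comp_lfunNr !comp_lfunA.
by rewrite addrC addrA subrK.
Qed.

(* The terms of [der f w] with trivial [x]. *)
Definition lead (f : hsp M) j k (w : qpath j k) : 'Hom(M j, N k) :=
  \sum_(a : {l : Q & arr l k})
    \sum_(y <- occ (tagged a) w | plen y.2 == 0%N)
      (defect f (tagged a) \o path_act M y.1)%VF.

Lemma lead_cons (f : hsp M) j l k (a : arr l k) (p : qpath j l) :
  lead f (PCons a p) = (defect f a \o path_act M p)%VF.
Proof.
rewrite /lead (bigD1 (existT (fun l => arr l k) l a)) //=.
rewrite (occ_lead a a p (fun y => defect f a \o path_act M y)%VF).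
rewrite sum_here_same big1 ?addr0 // => -[l' b] /= ne.
rewrite (occ_lead b a p (fun y => defect f b \o path_act M y)%VF).
rewrite here_diff ?big_nil // => e; case/eqP: ne.
suff : (fun y : arrowT Q => forall e : (tag y).2 = k, existT (fun l => arr l k) (tag y).1 (ecast x (arr (tag y).1 x) e (tagged y)) = existT (fun l => arr l k) l a) (mkarrow b).
  by move/(_ erefl).
rewrite -e => e'; by rewrite (eq_axiomK e').
Qed.

(** In every term N(q) N(x) (defect f a) M(y) the path q x to the left of the defect is at least as
    long as [q]. *)
Lemma der_small (f : hsp M) d :
  (forall l k (a : arr l k) s (r : qpath k s), (d < plen r)%N ->
     (path_act N r \o defect f a)%VF = 0) ->
  forall j k (w : qpath j k) s (q : qpath k s), (d < plen q)%N ->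
    (path_act N q \o der f w)%VF = 0.
Proof.
move=> H j k; elim=> [|l i a p IH] s q hq /=; first by rewrite comp_lfun0r.
rewrite comp_lfunDr !comp_lfunA H // comp_lfun0l add0r.
have := IH _ (pcat q (parrow a)); rewrite path_act_pcat /= comp_lfun1r; apply.
by rewrite plen_pcat addn1; apply: ltnW.
Qed.

(** A nontrivial [x] makes q x longer than [d] even when [q] has length exactly [d], so only the
    terms with trivial [x] survive. *)
Lemma der_lead (f : hsp M) d :
  (forall l k (a : arr l k) s (r : qpath k s), (d < plen r)%N ->
     (path_act N r \o defect f a)%VF = 0) ->
  forall j k (w : qpath j k) s (q : qpath k s), (d <= plen q)%N ->
    (path_act N q \o der f w)%VF = (path_act N q \o lead f w)%VF.
Proof.
move=> H j k [|l i a p] s q hq /=.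
  rewrite /lead big1 // => a _; exact: big_nil.
rewrite lead_cons comp_lfunDr !comp_lfunA [X in _ + X](_ : _ = 0) ?addr0 //.
have := der_small H p (q := pcat q (parrow a)).
rewrite path_act_pcat /= comp_lfun1r; apply.
by rewrite plen_pcat addn1.
Qed.

Hypothesis nl : loopless Q.
Hypothesis MJ : is_jacobian_module M S.
Hypothesis NJ : is_jacobian_module N S.

(** [derE] turns the sum into a difference of two terms, one containing the action of d_b S on N and
    one its action on M; both actions vanish because d_b S lies in J_0. *)
Lemma der_cyc_deriv (f : hsp M) k i (b : arr k i) :
  \sum_(c <- msupp S) S@_c *: \sum_(x <- occ b (tagged c)) der f (pcat x.1 x.2) = 0.
Proof.
have E (R : fdrep K Q) : is_jacobian_module R S ->
    \sum_(c <- msupp S) S@_c *: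
      \sum_(x <- occ b (tagged c)) path_act R (pcat x.1 x.2) = 0.
  move=> RJ; transitivity (act R (cyc_deriv S b)); last first.
    by apply: RJ => I hI; apply; exists b.
  rewrite /cyc_deriv linear_sum; apply: eq_bigr => c _.
  rewrite linearZ /= [act R _]linear_sum; congr (_ *: _); apply: eq_bigr => x _.
  by rewrite [RHS]actU.
transitivity (((\sum_(c <- msupp S) S@_c *:
   \sum_(x <- occ b (tagged c)) path_act N (pcat x.1 x.2)) \o f i)
   - (f k \o (\sum_(c <- msupp S) S@_c *:
   \sum_(x <- occ b (tagged c)) path_act M (pcat x.1 x.2))))%VF; last first.
  by rewrite !E // comp_lfun0l comp_lfun0r subr0.
rewrite comp_lfun_suml comp_lfun_sumr -sumrB; apply: eq_bigr => c _.
rewrite -comp_lfunZl -comp_lfunZr -scalerBr comp_lfun_suml comp_lfun_sumr -sumrB.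
by congr (_ *: _); apply: eq_bigr => x _; rewrite derE.
Qed.

Lemma act_cyc_deriv2 (R : fdrep K Q) l k i (b : arr k i) (a : arr l k) :
  act R (cyc_deriv2 S b a) = \sum_(c <- msupp S) S@_c *:
    \sum_(x <- occ b (tagged c))
      \sum_(y <- occ a (pcat x.1 x.2) | plen y.2 == 0%N) path_act R y.1.
Proof.
rewrite /cyc_deriv2 linear_sum; apply: eq_bigr => c _; rewrite linearZ /=.
congr (_ *: _).
rewrite -(cyc_deriv2_lead nl b a c (fun p => path_act R p)) [act R _]linear_sum.
apply: eq_bigr => x _; rewrite [LHS]linear_sum; apply: eq_bigr => y _.
by rewrite [LHS]actU.
Qed.

Lemma gamma_in (R : fdrep K Q) k (b : {i : Q & arr k i}) :
  (gamma R S k \o dvsum_in _ b)%VF =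
  \sum_(a : {l : Q & arr l k}) (dvsum_in _ a \o act R (cyc_deriv2 S (tagged b) (tagged a)))%VF.
Proof.
rewrite /gamma comp_lfun_suml; apply: eq_bigr => a _.
exact: (@dvsum_hom_in K _ (fun b : {i : Q & arr k i} => R (tag b))).
Qed.

(** Grouped by leading letter a, the leading terms of d_b S are the defect at a composed with a^{-1}
    d_b S = d_{ba} S, which is the entry of [gamma] from the summand of b to that of a. *)
Lemma lead_cyc_deriv (f : hsp M) k (b : {i : Q & arr k i}) :
  \sum_(c <- msupp S) S@_c *:
    \sum_(x <- occ (tagged b) (tagged c)) lead f (pcat x.1 x.2) =
  (phistar f k \o gamma M S k \o dvsum_in _ b)%VF.
Proof.
rewrite -comp_lfunA gamma_in comp_lfun_sumr.
under [RHS]eq_bigr do rewrite comp_lfunA phistar_in act_cyc_deriv2 comp_lfun_sumr.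
rewrite exchange_big; apply: eq_bigr => c _ /=.
under [RHS]eq_bigr do rewrite -comp_lfunZr comp_lfun_sumr.
rewrite -scaler_sumr exchange_big; congr (_ *: _); apply: eq_bigr => x _ /=.
by apply: eq_bigr => a _; rewrite comp_lfun_sumr.
Qed.

Lemma path_phistar_gamma (f : hsp M) d :
  (forall l k (a : arr l k) s (r : qpath k s), (d < plen r)%N ->
     (path_act N r \o defect f a)%VF = 0) ->
  forall k s (q : qpath k s), (d <= plen q)%N ->
    (path_act N q \o phistar f k \o gamma M S k)%VF = 0.
Proof.
move=> H k s q hq; apply: dvsum_hom_ext => b; rewrite comp_lfun0l.
rewrite -!comp_lfunA [X in (_ \o X)%VF]comp_lfunA -lead_cyc_deriv.
transitivity (path_act N q \o \sum_(c <- msupp S) S@_c *: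
  \sum_(x <- occ (tagged b) (tagged c)) der f (pcat x.1 x.2))%VF; last first.
  by rewrite der_cyc_deriv comp_lfun0r.
rewrite !comp_lfun_sumr; apply: eq_bigr => c _.
rewrite -!comp_lfunZr !comp_lfun_sumr; congr (_ *: _).
by apply: eq_bigr => x _; rewrite (der_lead H).
Qed.

End HomSpace.

(** * Extension from M^(0), and the dimension of the image *)

Section Splitting.
Variables (K : fieldType) (Q : quiver) (S : potential K Q) (M N : fdrep K Q).
Implicit Types (i j k l s : Q).
Hypothesis nl : loopless Q.
Hypothesis MJ : is_jacobian_module M S.
Hypothesis NJ : is_jacobian_module N S.
Variable n : nat.
Hypothesis Sn : forall j i (x : PA K j i),
  ideal_exp (@arrow_ideal K Q) n x -> jacobian_ideal S x.
Variable spl : splitting S M.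

Lemma vanish_dsum (V W : vectType K) (f : 'Hom(V, W)) (A B C : {vspace V}) :
  is_direct_sum A B C -> (forall u, u \in A -> f u = 0) ->
  (forall u, u \in B -> f u = 0) -> forall u, u \in C -> f u = 0.
Proof.
move=> [<- _] hA hB u /memv_addP[v hv [w hw ->]].
by rewrite linearD /= hA // hB // addr0.
Qed.

(** M_in(k) is the sum of im gamma_k, U'_k and U''_k; the hypotheses settle the last two, and
    [path_phistar_gamma] settles the first for one path length at a time. *)
Lemma phistar_eq0 (f : hsp N M) :
  (forall k u, u \in U1 spl k -> phistar f k u = 0) ->
  (forall k u, u \in U2 spl k -> phistar f k u = 0) -> phistar f = 0.
Proof.
move=> h1 h2.
(* [m] counts the remaining steps: at m = 0 the path [q] has length at least [n], and the goal is
   the case m = n, d = 0 with [q] trivial. *)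
suff H m d k s (q : qpath k s) : (n <= m + d)%N -> (d <= plen q)%N ->
    (path_act N q \o phistar f k)%VF = 0.
  apply: dvsum_ext => k; rewrite -[LHS]comp_lfun1l.
  by have := H n 0%N k k (PNil k); apply; rewrite ?addn0.
elim: m d k s q => [|m IH] d k s q.
  move=> hn hd; rewrite (path_act_eq0 Sn NJ) ?comp_lfun0l //.
  exact: leq_trans hn hd.
move=> hn hd.
(* A defect is a component of [phistar f], so the induction hypothesis at [d.+1] applies to it. *)
have H l k' (a : arr l k') s' (r : qpath k' s') : (d < plen r)%N ->
    (path_act N r \o defect f a)%VF = 0.
  move=> hr; rewrite -(phistar_in f (existT (fun l => arr l k') l a)) comp_lfunA.
  by rewrite (IH d.+1) ?comp_lfun0l // addnS -addSn.
have hg := path_phistar_gamma nl MJ NJ H hd.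
apply/lfunP => u; rewrite [RHS]zero_lfunE.
apply: (vanish_dsum (U2P spl k)) (memvf u) => {}u.
  apply: (vanish_dsum (U1P spl k)) => {}u.
    move=> /memv_imgP[v _ ->].
    by rewrite -[LHS](comp_lfunE _ (gamma M S k)) hg zero_lfunE.
  by move=> hu; rewrite comp_lfunE h1 // linear0.
by move=> hu; rewrite comp_lfunE h2 // linear0.
Qed.

(** On U'' the condition phi^* f = 0 reads f(alpha v) = sum_a a_N f(v_a), which trades a value of
    [f] on im alpha for values of [f] followed by one more arrow. *)
Lemma hsp_eq0 (f : hsp N M) :
  (forall k u, u \in M0 spl k -> f k u = 0) ->
  (forall k u, u \in U2 spl k -> phistar f k u = 0) -> f = 0.
Proof.
move=> h0 h2.
suff H m d k s (q : qpath k s) : (n <= m + d)%N -> (d <= plen q)%N ->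
    (path_act N q \o f k)%VF = 0.
  apply: dvsum_ext => k; rewrite -[LHS]comp_lfun1l.
  by have := H n 0%N k k (PNil k); apply; rewrite ?addn0.
elim: m d k s q => [|m IH] d k s q.
  move=> hn hd; rewrite (path_act_eq0 Sn NJ) ?comp_lfun0l //.
  exact: leq_trans hn hd.
move=> hn hd; apply/lfunP => u; rewrite [RHS]zero_lfunE.
apply: (vanish_dsum (M0P spl k)) (memvf u) => {}u.
  by move=> hu; rewrite comp_lfunE h0 // linear0.
move=> /memv_imgP[v _ ->]; rewrite -[LHS](comp_lfunE _ (alpha M k)).
apply: (vanish_dsum (U2P spl k)) (memvf v) => {}v.
  by rewrite memv_ker comp_lfunE => /eqP ->; rewrite linear0.
move=> /h2; rewrite phistarE => /eqP; rewrite subr_eq0 => /eqP e.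
rewrite !comp_lfunE -e linear_sum big1 // => a _.
have := IH d.+1 _ _ (pcat q (parrow (tagged a))).
rewrite path_act_pcat plen_pcat /= comp_lfun1r addn1 addnS -addSn => /(_ hn hd).
by move/(congr1 (fun F : 'Hom(_, _) => F (v a))); rewrite !comp_lfunE zero_lfunE.
Qed.

Definition hsp_restrict (U : Q -> vectType K) (W : forall k, {vspace (U k)})
    (f : hsp N U) : hsp N (sub_fam W) :=
  fun k => (f k \o linfun (vsval : subvs_of (W k) -> U k))%VF.

Lemma hsp_restrictE (U : Q -> vectType K) (W : forall k, {vspace (U k)})
    (f : hsp N U) k w : hsp_restrict W f k w = f k (vsval w).
Proof. by rewrite comp_lfunE lfunE. Qed.

Lemma hsp_restrict_linear (U : Q -> vectType K) (W : forall k, {vspace (U k)}) :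
  linear (@hsp_restrict U W).
Proof.
move=> c f g; apply: dvsum_ext => k.
rewrite [RHS]/(c *: hsp_restrict W f k + hsp_restrict W g k) /hsp_restrict.
by rewrite comp_lfunZl; exact: comp_lfunDl.
Qed.

HB.instance Definition _ U W := GRing.isLinear.Build K _ _ _ (@hsp_restrict U W)
  (@hsp_restrict_linear U W).

Lemma hsp_restrict_eq0 (U : Q -> vectType K) (W : forall k, {vspace (U k)})
    (f : hsp N U) :
  hsp_restrict W f = 0 <-> forall k u, u \in W k -> f k u = 0.
Proof.
split=> [h k u hu|h].
  have := congr1 (fun g : hsp N (sub_fam W) => g k (vsproj (W k) u)) h.
  by rewrite hsp_restrictE vsprojK // [RHS]zero_lfunE.
apply: dvsum_ext => k; apply/lfunP => w.
by rewrite hsp_restrictE h ?subvsP // [RHS]zero_lfunE.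
Qed.

(* The families that correspond to homomorphisms killing [phi(P'')]. *)
Definition lifts : {vspace (hsp N M)} :=
  lker (linfun (fun f : hsp N M => hsp_restrict (U2 spl) (phistar f))).

Lemma liftsP (f : hsp N M) :
  reflect (forall k u, u \in U2 spl k -> phistar f k u = 0) (f \in lifts).
Proof.
rewrite memv_ker linfunE; last by move=> c g h; rewrite !linearP.
by apply: (iffP eqP) => /hsp_restrict_eq0.
Qed.

Lemma dim_hsp (U : Q -> vectType K) :
  \dim {:hsp N U} = (\sum_k \dim {:U k} * \dim {:N k})%N.
Proof. by rewrite dim_dvsum; apply: eq_bigr => k _; rewrite dim_Hom. Qed.

Lemma dim_direct_sum (V : vectType K) (A B C : {vspace V}) :
  is_direct_sum A B C -> (\dim A + \dim B)%N = \dim C.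
Proof. by case=> <- d; rewrite dimv_disjoint_sum. Qed.

Lemma dim_U2 k : \dim (U2 spl k) = \dim (limg (alpha M k)).
Proof.
have := limg_ker_dim (alpha M k) fullv; rewrite capfv -(dim_direct_sum (U2P spl k)).
by move/eqP; rewrite eqn_add2l => /eqP.
Qed.

(** The map defining [lifts] takes values in the families on U'', and dim M(k) = dim M^(0)(k) + dim
    U''_k because [alpha] maps U''_k isomorphically onto its image. *)
Lemma dim_lifts_le : (\dim {:hsp N (sub_fam (M0 spl))} <= \dim lifts)%N.
Proof.
pose F := linfun (fun f : hsp N M => hsp_restrict (U2 spl) (phistar f)).
have := limg_ker_dim F fullv; rewrite capfv -/lifts => e.
have : (\dim {:hsp N M} <= \dim lifts + \dim {:hsp N (sub_fam (U2 spl))})%N.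
  by rewrite -e leq_add2l dimvS ?subvf.
suff -> : \dim {:hsp N M} =
   (\dim {:hsp N (sub_fam (M0 spl))} + \dim {:hsp N (sub_fam (U2 spl))})%N.
  by rewrite leq_add2r.
rewrite !dim_hsp -big_split; apply: eq_bigr => k _ /=.
by rewrite !dim_subvs dim_U2 -mulnDl (dim_direct_sum (M0P spl k)).
Qed.

Lemma hsp_restrict_lifts_inj (f : hsp N M) :
  f \in lifts -> hsp_restrict (M0 spl) f = 0 -> f = 0.
Proof. by move=> /liftsP h2 /hsp_restrict_eq0 h0; apply: hsp_eq0. Qed.

Lemma hsp_restrict_lifts_aux :
  (lifts :&: lker (linfun (hsp_restrict (M0 spl))))%VS = 0%VS.
Proof.
apply/eqP; rewrite -subv0; apply/subvP => f.
rewrite memv_cap memv_ker lfunE => /andP[h /eqP h0].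
by rewrite (hsp_restrict_lifts_inj h h0) mem0v.
Qed.

Lemma hsp_restrict_lifts_surj : (linfun (hsp_restrict (M0 spl)) @: lifts)%VS = fullv.
Proof.
apply/eqP; rewrite eqEdim subvf /= limg_dim_eq ?hsp_restrict_lifts_aux //.
exact: dim_lifts_le.
Qed.

Lemma dim_lifts : \dim lifts = \dim {:hsp N (sub_fam (M0 spl))}.
Proof. by rewrite -hsp_restrict_lifts_surj limg_dim_eq ?hsp_restrict_lifts_aux. Qed.

Lemma lift_exists (g : hsp N (sub_fam (M0 spl))) :
  exists2 f : hsp N M, f \in lifts & hsp_restrict (M0 spl) f = g.
Proof.
have /memv_imgP[f h e] : g \in (linfun (hsp_restrict (M0 spl)) @: lifts)%VS.
  by rewrite hsp_restrict_lifts_surj memvf.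
by exists f => //; rewrite e lfunE.
Qed.

(* The image of [phibar^*], see [phibar_star_imP]. *)
Definition trace : {vspace hsp N (sub_fam (U1 spl))} :=
  (linfun (fun f : hsp N M => hsp_restrict (U1 spl) (phistar f)) @: lifts)%VS.

Definition homs : {vspace hsp N M} := lker (linfun (@phistar K Q M N)).

(** Rank-nullity on [lifts]: a member whose phi^* f vanishes on U' has phi^* f = 0 by [phistar_eq0],
    and conversely [homs] is contained in [lifts]. *)
Lemma dim_trace :
  (\dim trace + \dim homs = \dim {:hsp N (sub_fam (M0 spl))})%N.
Proof.
rewrite -dim_lifts -(limg_ker_dim (linfun (fun f : hsp N M => hsp_restrict (U1 spl) (phistar f))) lifts).
rewrite addnC; congr (\dim _ + _)%N.
have L : linear (fun f : hsp N M => hsp_restrict (U1 spl) (phistar f)).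
  by move=> c g h; rewrite !linearP.
apply/vspaceP => f; rewrite memv_cap; apply/idP/andP => [|[/liftsP h2]].
  rewrite /homs memv_ker lfunE => /eqP e; split.
    by apply/liftsP => k u _; rewrite e [LHS]zero_lfunE.
  by rewrite memv_ker (linfunE L) e linear0.
rewrite /homs !memv_ker lfunE (linfunE L) => /eqP/hsp_restrict_eq0 h1.
by apply/eqP; exact: phistar_eq0.
Qed.

End Splitting.

(** * Tensor products and direct sums in coordinates *)

Section TensorTheory.
Variable K : fieldType.

Lemma ptensor_linear_r (P : lmodType K) (U : vectType K) (p : P) :
  linear (fun u : U => ptensor p u).
Proof. by move=> c u v; apply/ffunP => m; rewrite !ffunE linearP scalerDl scalerA. Qed.

Lemma ptensor_linear_l (P : lmodType K) (U : vectType K) (u : U) :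
  linear (fun p : P => ptensor p u).
Proof.
by move=> c p q; apply/ffunP => m; rewrite !ffunE scalerDr !scalerA mulrC.
Qed.

Lemma ptensor_sumr (P : lmodType K) (U : vectType K) (p : P) (I : finType)
    (c : I -> K) (u : I -> U) :
  ptensor p (\sum_i c i *: u i) = \sum_i c i *: ptensor p (u i).
Proof.
pose f : {linear U -> tensor P U} :=
  linear_pack (@ptensor_linear_r P U p).
by rewrite -[LHS]/(f _) linear_sum; apply: eq_bigr => i _; rewrite linearZ.
Qed.

Lemma tensor_decomp (P : lmodType K) (U : vectType K) (x : tensor P U) :
  x = \sum_m ptensor (x m) (vbasis {:U})`_m.
Proof.
apply/ffunP => j; rewrite sum_ffunE (bigD1 j) //= ffunE.
rewrite coord_free ?(basis_free (vbasisP _)) // eqxx scale1r big1 ?addr0 //.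
move=> m ne; rewrite ffunE coord_free ?(basis_free (vbasisP _)) //.
by rewrite (negbTE ne) scale0r.
Qed.

Lemma tensor_map_linear (P P' : lmodType K) (U U' : vectType K)
    (f : P -> P') (g : 'Hom(U, U')) : linear f -> linear (tensor_map f g).
Proof.
move=> fL c x y; rewrite /tensor_map scaler_sumr -big_split; apply: eq_bigr => m _.
by rewrite /= -ptensor_linear_l -fL !ffunE.
Qed.

Lemma tensor_mapE (P P' : lmodType K) (U U' : vectType K)
    (f : P -> P') (g : 'Hom(U, U')) (p : P) (u : U) :
  linear f -> tensor_map f g (ptensor p u) = ptensor (f p) (g u).
Proof.
move=> fL; rewrite {2}(coord_vbasis (memvf u)) linear_sum.
under [in RHS]eq_bigr do rewrite linearZ.
rewrite (ptensor_sumr (f p) (fun i => coord (vbasis {:U}) i u)).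
rewrite /tensor_map; apply: eq_bigr => m _.
pose F : {linear P -> P'} := linear_pack fL.
rewrite ffunE -[f _]/(F _) linearZ /=.
by apply/ffunP => j; rewrite !ffunE scalerA mulrC -scalerA.
Qed.

End TensorTheory.

Section DsumTheory.
Variables (K : fieldType) (I : finType) (V : I -> lmodType K).

Lemma dsum_ext (x y : dsum V) : (forall i, x i = y i) -> x = y.
Proof. exact: functional_extensionality_dep. Qed.

Lemma dsum_in_linear i : linear (@dsum_in K I V i).
Proof.
move=> c x y; apply: dsum_ext => j.
rewrite [RHS]/(c *: dsum_in x j + dsum_in y j) /dsum_in.
have [<-|ne] := eqVneq i j; first by rewrite !dfwith_in.
by rewrite !dfwith_out // scaler0; exact: esym (addr0 _).
Qed.

HB.instance Definition _ i := GRing.isLinear.Build K _ _ _ (@dsum_in K I V i)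
  (@dsum_in_linear i).

Lemma dsum_sumE (J : Type) (r : seq J) (P : pred J) (F : J -> dsum V) i :
  (\sum_(j <- r | P j) F j) i = \sum_(j <- r | P j) F j i.
Proof. exact: (big_morph (fun x : dsum V => x i)). Qed.

Lemma dsum_decomp (x : dsum V) : x = \sum_i dsum_in (x i).
Proof.
apply: dsum_ext => j; rewrite dsum_sumE (bigD1 j) //= /dsum_in dfwith_in.
by rewrite big1 ?addr0 // => i ne; rewrite dfwith_out.
Qed.

End DsumTheory.

(** * Projective modules, and phi on pure tensors *)

Section ProjTheory.
Variables (K : fieldType) (Q : quiver) (S : potential K Q).
Implicit Types (i j k l s : Q).

(** The pure tensor of [x] and [u] in the summand [k]. With [x] a path class these span the module,
    so linear maps are compared on them. *)
Definition pgen (U : Q -> vectType K) k i (x : jacobian S k i) (u : U k) : proj S U i :=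
  dsum_in (V := fun k => tensor (jacobian S k i) (U k)) (ptensor x u).

Lemma pgen_linear_l (U : Q -> vectType K) k i (u : U k) :
  linear (fun x : jacobian S k i => pgen x u).
Proof. by move=> c x y; rewrite /pgen ptensor_linear_l linearP. Qed.

Lemma pgen_linear_r (U : Q -> vectType K) k i (x : jacobian S k i) :
  linear (fun u : U k => pgen x u).
Proof. by move=> c u v; rewrite /pgen ptensor_linear_r linearP. Qed.

HB.instance Definition _ U k i x := GRing.isLinear.Build K _ _ _
  (@pgen U k i x) (@pgen_linear_r U k i x).

Lemma proj_ind (U : Q -> vectType K) i (X : proj S U i -> Prop) :
  (forall x y, X x -> X y -> X (x + y)) -> (forall c x, X x -> X (c *: x)) ->
  X 0 -> (forall k (p : qpath k i) (u : U k), X (pgen (jpath S p) u)) ->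
  forall x, X x.
Proof.
move=> XD XZ X0 Xp x; rewrite (dsum_decomp x); apply: big_ind => // k _.
rewrite [x k]tensor_decomp linear_sum; apply: big_ind => // m _.
pose F : {linear jacobian S k i -> proj S U i} := linear_pack (@pgen_linear_l U k i (vbasis {:U k})`_m).
change (X (F (x k m))).
elim/jacobian_ind: (x k m) => [y z Xy Xz|c y Xy||p].
- by rewrite linearD; apply: XD.
- by rewrite linearZ; apply: XZ.
- by rewrite linear0.
- exact: Xp.
Qed.

Lemma proj_ext (U : Q -> vectType K) i (V : lmodType K) (f g : proj S U i -> V) :
  linear f -> linear g ->
  (forall k (p : qpath k i) (u : U k), f (pgen (jpath S p) u) = g (pgen (jpath S p) u)) ->
  f =1 g.
Proof.
move=> fL gL h.
pose F : {linear proj S U i -> V} := linear_pack fL.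
pose G : {linear proj S U i -> V} := linear_pack gL.
move=> x; rewrite -[f x]/(F x) -[g x]/(G x); elim/proj_ind: x => [x y ex ey|c x ex||k p u].
- by rewrite !linearD ex ey.
- by rewrite !linearZ ex.
- by rewrite !linear0.
- exact: h.
Qed.

Lemma proj_map_linear (U U' : Q -> vectType K) (g : forall k, 'Hom(U k, U' k)) i :
  linear (proj_map (S := S) g (i := i)).
Proof.
move=> c x y; apply: dsum_ext => k.
exact: (tensor_map_linear (g k) (f := fun p : jacobian S k i => p)).
Qed.

HB.instance Definition _ U U' g i := GRing.isLinear.Build K _ _ _
  (@proj_map K Q S U U' g i) (@proj_map_linear U U' g i).

Lemma tensor_map0 (P P' : lmodType K) (U U' : vectType K)
    (f : P -> P') (g : 'Hom(U, U')) : linear f -> tensor_map f g 0 = 0.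
Proof.
move=> fL.
pose F : {linear tensor P U -> tensor P' U'} := linear_pack (tensor_map_linear g fL).
exact: (linear0 F).
Qed.

Lemma proj_map_gen (U U' : Q -> vectType K) (g : forall k, 'Hom(U k, U' k)) k i
    (x : jacobian S k i) (u : U k) :
  proj_map g (pgen x u) = pgen x (g k u).
Proof.
apply: dsum_ext => j; rewrite /proj_map /pgen /dsum_in.
have [<-|ne] := eqVneq k j; first by rewrite !dfwith_in tensor_mapE.
by rewrite !dfwith_out // tensor_map0.
Qed.

Section Phi.
Variable M : fdrep K Q.

Lemma phi_linear i : linear (@phi K Q S M i).
Proof.
move=> c x y; rewrite /phi scaler_sumr -big_split; apply: eq_bigr => k _ /=.
rewrite scalerBr addrACA -opprD; congr (_ - _).
  rewrite scaler_sumr -big_split; apply: eq_bigr => a _ /=.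
  by rewrite -linearP -tensor_map_linear //; exact: linearP.
by rewrite -linearP -tensor_map_linear.
Qed.

HB.instance Definition _ i := GRing.isLinear.Build K _ _ _
  (@phi K Q S M i) (@phi_linear i).

Lemma phi_gen k i (x : jacobian S k i) (u : M_in M k) :
  phi (pgen x u) =
    \sum_(a : {l : Q & arr l k}) pgen (U := M) (jac_rmul (tagged a) x) (u a)
    - pgen x (alpha M k u).
Proof.
rewrite /phi (bigD1 k) //= [X in _ + X]big1 ?addr0; last first.
  move=> j ne; rewrite /pgen /dsum_in dfwith_out 1?eq_sym //.
  rewrite big1 ?tensor_map0 ?add0r // => [|a _].
    by rewrite -[dfwith _ _]/(dsum_in _) linear0 oppr0.
  rewrite tensor_map0; last by exact: linearP.
  by rewrite -[dfwith _ _]/(dsum_in _) linear0.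
have -> : (pgen x u : dsum _) k = ptensor x u by rewrite /pgen /dsum_in dfwith_in.
congr (_ - _); last by rewrite tensor_mapE.
apply: eq_bigr => a _; rewrite tensor_mapE; last by exact: linearP.
by rewrite (@dvsum_prE K _ (fun x : {l : Q & arr l k} => M (tag x))).
Qed.

End Phi.
End ProjTheory.

(** * The Yoneda identification *)

Section Yoneda.
Variables (K : fieldType) (Q : quiver) (S : potential K Q) (N : fdrep K Q).
Implicit Types (i j k l s : Q) (U : Q -> vectType K).
Hypothesis NJ : is_jacobian_module N S.

(* [p (x) u |-> p_N (f u)], in the coordinates that define [tensor]. *)
Definition hat U (f : hsp N U) i (x : proj S U i) : N i :=
  \sum_k \sum_m jact N (x k m) (f k (vbasis {:U k})`_m).

Lemma hat_linear U (f : hsp N U) i : linear (hat f (i := i)).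
Proof.
move=> c x y; rewrite /hat scaler_sumr -big_split; apply: eq_bigr => k _ /=.
rewrite scaler_sumr -big_split; apply: eq_bigr => m _ /=.
rewrite [(c *: x + y) k m](_ : _ = c *: x k m + y k m); last by rewrite [LHS]ffunE ffunE.
by rewrite (jact_linear NJ) !lfunE /= !lfunE.
Qed.

Lemma hat_linear_f U i (x : proj S U i) : linear (fun f : hsp N U => hat f x).
Proof.
move=> c f g; rewrite /hat scaler_sumr -big_split; apply: eq_bigr => k _ /=.
rewrite scaler_sumr -big_split; apply: eq_bigr => m _ /=.
rewrite [(c *: f + g) k]/(c *: f k + g k).
by rewrite !lfunE /= !lfunE /= linearP.
Qed.

Lemma jact0 k i : jact N (0 : jacobian S k i) = 0.
Proof. exact: (linear0 (linear_pack (@jact_linear K Q S N NJ k i))). Qed.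

Lemma jactZ k i c (x : jacobian S k i) : jact N (c *: x) = c *: jact N x.
Proof. by have := @jact_linear K Q S N NJ k i c x 0; rewrite jact0 !addr0. Qed.

Lemma hat_gen U (f : hsp N U) k i (x : jacobian S k i) (u : U k) :
  hat f (pgen x u) = jact N x (f k u).
Proof.
have E : (pgen x u : dsum _) k = ptensor x u by rewrite /pgen /dsum_in dfwith_in.
rewrite /hat (bigD1 k) //= E [X in _ + X]big1 ?addr0 => [|j ne].
  rewrite [in RHS](coord_vbasis (memvf u)) !linear_sum; apply: eq_bigr => m _.
  by rewrite !linearZ ffunE jactZ !lfunE.
apply: big1 => m _; rewrite /pgen /dsum_in dfwith_out 1?eq_sym // ffunE.
by rewrite jact0 lfunE.
Qed.

Lemma hat_comm U (f : hsp N U) i j (a : arr i j) (x : proj S U i) :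
  hat f (proj_act a x) = fd_map N a (hat f x).
Proof.
rewrite /hat linear_sum; apply: eq_bigr => k _; rewrite linear_sum.
by apply: eq_bigr => m _; rewrite /proj_act ffunE jact_lmul // comp_lfunE.
Qed.

Lemma hat_hom_pred U (f : hsp N U) :
  (fun i => hat f (i := i)) \in @hom_pred K Q (proj S U) N.
Proof.
by apply/asboolP; split=> [i|i j a x]; [apply: hat_linear | apply: hat_comm].
Qed.

Definition hatHom U (f : hsp N U) : repHom (proj S U) N := RepHom (hat_hom_pred f).

Lemma repHom_ext (X Y : rep K Q) (g h : repHom X Y) :
  (forall i (x : X i), hom_val g x = hom_val h x) -> g = h.
Proof.
move=> e; apply: val_inj; apply: functional_extensionality_dep => i.
by apply: functional_extensionality_dep => x; apply: e.
Qed.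

Lemma hatHom_linear U : linear (@hatHom U).
Proof. by move=> c f g; apply: repHom_ext => i x; apply: hat_linear_f. Qed.

Lemma hatHom_inj U : injective (@hatHom U).
Proof.
move=> f g e; apply: dvsum_ext => k; apply/lfunP => u.
have : hat f (pgen (jpath S (PNil k)) u) = hat g (pgen (jpath S (PNil k)) u).
  exact: (congr1 (fun h : repHom _ _ => hom_val h (pgen (jpath S (PNil k)) u)) e).
by rewrite !hat_gen !jact_path // !id_lfunE.
Qed.

(** A homomorphism is determined by its values on the generators e_k (x) u, from which every path is
    reached by left multiplication with arrows; these values form the family. *)
Lemma hatHom_surj U (h : repHom (proj S U) N) : exists f : hsp N U, hatHom f = h.
Proof.
have /asboolP[hL hC] := hom_valP h.
have L k : linear (fun u : U k => hom_val h (pgen (jpath S (PNil k)) u)).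
  by move=> c u v; rewrite pgen_linear_r hL.
exists (fun k => linfun (fun u : U k => hom_val h (pgen (jpath S (PNil k)) u))).
apply: repHom_ext => i x; apply: proj_ext x => [||k p u]; [exact: hat_linear|exact: hL|].
rewrite [LHS]hat_gen jact_path // (linfunE (L k)).
elim: p => [|l i' a p IH] /=; first by rewrite id_lfunE.
rewrite comp_lfunE IH -[LHS]hC; congr (hom_val h _).
apply: dsum_ext => m; rewrite /= /proj_act /pgen /dsum_in.
have [<-|ne] := eqVneq k m; apply/ffunP => r.
  by rewrite !dfwith_in !ffunE linearZ /= jac_lmul_path.
by rewrite !dfwith_out // !ffunE linear0.
Qed.

Lemma hat_proj_map U U' (g : forall k, 'Hom(U k, U' k)) (f : hsp N U')
    (f' : hsp N U) i (x : proj S U i) :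
  (forall k u, f k (g k u) = f' k u) -> hat f (proj_map g x) = hat f' x.
Proof.
move=> e; move: x.
apply: (proj_ext (f := fun x => hat f (proj_map g x)) (g := hat f' (i := i)))
  => [c x y||k p u]; [|exact: hat_linear|].
  by rewrite linearP hat_linear.
by rewrite proj_map_gen !hat_gen e.
Qed.

Lemma hat_incl U (W : forall k, {vspace (U k)}) (f : hsp N U) i
    (x : proj S (sub_fam W) i) : hat f (proj_incl x) = hat (hsp_restrict W f) x.
Proof. by apply: hat_proj_map => k u; rewrite hsp_restrictE lfunE. Qed.

(** On p (x) u, the term p a (x) u_a contributes N(p) a_N f(u_a) and the term p (x) alpha(u)
    contributes N(p) f(alpha u); the difference is N(p) applied to [phistarE]. *)
Lemma hat_phi (M : fdrep K Q) (f : hsp N M) i (x : proj S (M_in M) i) :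
  hat f (phi x) = hat (phistar f) x.
Proof.
move: x; apply: (proj_ext (f := fun x => hat f (phi x)) (g := hat (phistar f) (i := i)))
  => [c x y||k p u]; [|exact: hat_linear|].
  by rewrite linearP hat_linear.
rewrite phi_gen hat_gen phistarE jact_path //.
pose H : {linear proj S M i -> N i} := linear_pack (@hat_linear M f i).
rewrite -[LHS]/(H _) !linearB [X in X - _ = _]linear_sum [X in _ = X - _]linear_sum; congr (_ - _).
  apply: eq_bigr => a _; rewrite [LHS]hat_gen jact_rmul // jact_path //.
  by rewrite comp_lfunE.
by rewrite [LHS]hat_gen jact_path.
Qed.

End Yoneda.

(** * The map phibar, its cokernel, and the space of homomorphisms *)

Section Cokernel.
Local Open Scope quotient_scope.
Variables (K : fieldType) (Q : quiver) (S : potential K Q) (M N : fdrep K Q).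
Implicit Types (i j k l s : Q).
Hypothesis nl : loopless Q.
Hypothesis MJ : is_jacobian_module M S.
Hypothesis NJ : is_jacobian_module N S.
Variable n : nat.
Hypothesis Sn : forall j i (x : PA K j i),
  ideal_exp (@arrow_ideal K Q) n x -> jacobian_ideal S x.
Variable spl : splitting S M.

Lemma proj_incl_gen (U : Q -> vectType K) (W : forall k, {vspace (U k)}) k i
    (x : jacobian S k i) (w : subvs_of (W k)) :
  proj_incl (pgen (U := sub_fam W) x w) = pgen x (vsval w).
Proof. by rewrite /proj_incl proj_map_gen lfunE. Qed.

Definition reachable i (q : proj S M i) : Prop :=
  exists z : P0 spl i, exists y : Psecond spl i,
    q = proj_incl z + phi (proj_incl y).

Lemma reachableD i (x y : proj S M i) :
  reachable x -> reachable y -> reachable (x + y).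
Proof.
move=> [z [u ->]] [z' [u' ->]]; exists (z + z'), (u + u').
by rewrite /proj_incl !linearD /= addrACA.
Qed.

Lemma reachableZ i c (x : proj S M i) : reachable x -> reachable (c *: x).
Proof.
by move=> [z [u ->]]; exists (c *: z), (c *: u); rewrite /proj_incl !linearZ /= scalerDr.
Qed.

Lemma reachable0 i : reachable (0 : proj S M i).
Proof. by exists 0, 0; rewrite /proj_incl !linear0 /= ?linear0 addr0. Qed.

Lemma reachableB i (x y : proj S M i) :
  reachable x -> reachable y -> reachable (x - y).
Proof. by move=> hx hy; rewrite -scaleN1r; apply/reachableD/reachableZ. Qed.

(** Since p (x) alpha(w) is the sum of the p a (x) w_a minus phi(p (x) w), whatever lies over im
    alpha is moved modulo phi(P'') to longer paths, which vanish from length [n] on. *)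
Lemma reachable_all i (q : proj S M i) : reachable q.
Proof.
elim/proj_ind: q => [||| k p u].
- exact: reachableD.
- exact: reachableZ.
- exact: reachable0.
suff H m d k' (p' : qpath k' i) (u' : M k') : (n <= m + d)%N -> (d <= plen p')%N ->
    reachable (pgen (jpath S p') u') by apply: (H n 0%N); rewrite ?addn0.
elim: m d k' p' u' => [|m IH] d k' p' u' hn hd.
  rewrite (jpath_eq0 Sn); last exact: leq_trans hn hd.
  rewrite [pgen _ _](linear0 (linear_pack (@pgen_linear_l K Q S M k' i u'))).
  exact: reachable0.
have [eM _] := M0P spl k'.
have : u' \in (M0 spl k' + limg (alpha M k'))%VS by rewrite eM memvf.
move=> /memv_addP[u0 h0 [u1 /memv_imgP[v _ ->] ->]]; rewrite linearD.
apply: reachableD.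
  exists (pgen (U := sub_fam (M0 spl)) (jpath S p') (vsproj (M0 spl k') u0)), 0.
  by rewrite proj_incl_gen vsprojK // /proj_incl !linear0 /= ?linear0 addr0.
have [eU _] := U2P spl k'.
have : v \in (lker (alpha M k') + U2 spl k')%VS by rewrite eU memvf.
move=> /memv_addP[w0 hw0 [w1 hw1 ->]]; rewrite linearD /=.
have -> : alpha M k' w0 = 0 by apply/eqP; rewrite -memv_ker.
rewrite add0r.
have -> : pgen (jpath S p') (alpha M k' w1) =
    \sum_(a : {l : Q & arr l k'}) pgen (U := M) (jac_rmul (tagged a) (jpath S p')) (w1 a)
    - phi (pgen (jpath S p') w1) by rewrite phi_gen opprB addrC subrK.
apply: reachableB.
  apply: big_ind => [||a _]; [exact: reachable0|exact: reachableD|].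
  rewrite jac_rmul_path; apply: (IH d.+1); first by rewrite addnS -addSn.
  by rewrite plen_pcat addn1.
exists 0, (pgen (U := sub_fam (U2 spl)) (jpath S p') (vsproj (U2 spl k') w1)).
by rewrite proj_incl_gen vsprojK // /proj_incl linear0 add0r.
Qed.

(** [phibar] is a choice with default 0; [reachable_all] makes the set chosen from nonempty, so the
    value satisfies the defining relation. *)
Lemma phibarP i (x : Pprime S M i) :
  exists y : Psecond spl i,
    phi (proj_incl x - proj_incl y) = proj_incl (phibar spl x).
Proof.
rewrite /phibar; case: xgetP => [z _ //|]; last move=> h.
have [z [y e]] := reachable_all (phi (proj_incl x)).
by case: (h z); exists y; rewrite linearB /= e addrK.
Qed.

(** Whichever [y] accompanies the chosen value, it contributes phi^* f evaluated on P'', which is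
    zero for [f] in [lifts]. *)
Lemma hat_phibar (f : hsp N M) i (x : P1 spl i) : f \in lifts N spl ->
  hat (hsp_restrict (M0 spl) f) (phibar spl (P1_incl x)) =
  hat (hsp_restrict (U1 spl) (phistar f)) x.
Proof.
move=> /liftsP/hsp_restrict_eq0 h2; rewrite -hat_incl //.
have [y <-] := phibarP (P1_incl x); rewrite hat_phi //.
pose H := linear_pack (@hat_linear K Q S N NJ (M_in M) (phistar f) i).
rewrite -[LHS]/(H _) linearB /= -[X in _ - X]/(hat _ _) -[X in X - _]/(hat _ _).
rewrite !hat_incl // h2 [X in _ - X](_ : _ = 0) ?subr0; last first.
  exact: (linear0 (linear_pack (@hat_linear_f K Q S N _ i y))).
apply: hat_proj_map => // k u; rewrite !hsp_restrictE linfunE; last first.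
  by move=> c v w; rewrite !linearP.
rewrite vsprojK // /ker_alpha; have [<- _] := U1P spl k.
by apply: subvP (addvSr _ _) _ (subvsP _).
Qed.

(** By [lift_exists] every homomorphism on P^(0) comes from a family in [lifts], to which
    [hat_phibar] applies. *)
Lemma phibar_star_imP (g : hsp N (sub_fam (U1 spl))) :
  phibar_star_im (spl := spl) (hatHom NJ g) <-> g \in trace N spl.
Proof.
have L : linear (fun f : hsp N M => hsp_restrict (U1 spl) (phistar f)).
  by move=> c f h; rewrite !linearP.
split=> [/asboolP[psi e]|/memv_imgP[f hf e]].
  have [g0 e0] := hatHom_surj NJ psi.
  have [f hf ef] := lift_exists NJ Sn g0.
  have -> : g = hsp_restrict (U1 spl) (phistar f).
    apply: (@hatHom_inj K Q S N NJ); apply: repHom_ext => i x.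
    by rewrite e -e0 -ef; apply: hat_phibar.
  by apply/memv_imgP; exists f => //; rewrite (linfunE L).
apply/asboolP; exists (hatHom NJ (hsp_restrict (M0 spl) f)) => i x.
by rewrite e (linfunE L); apply/esym/hat_phibar.
Qed.

Lemma coker_dim :
  has_dim (Eproj_coker spl N)
    (\dim {:hsp N (sub_fam (U1 spl))} - \dim (trace N spl)).
Proof.
pose I := phibar_star_im (spl := spl) (N := N).
pose pi (g : hsp N (sub_fam (U1 spl))) : Eproj_coker spl N :=
  (\pi_(lquot I) (hatHom NJ g))%qT.
have piL : linear pi.
  move=> c f g; rewrite /pi (@hatHom_linear K Q S N NJ) lquot_pi_add; congr (_ + _).
  by rewrite -[RHS]/(lquot_scale c _) lquot_scale_pi.
apply: (@has_dim_surj K _ _ (linear_pack piL)) => [x|g].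
  have [g e] := hatHom_surj NJ (repr (x : lquot I)).
  by exists g; rewrite /= /pi e; apply: (@reprK _ (lquot I)).
rewrite -phibar_star_imP /= /pi.
have E := @Quotient.idealrBE _ (zmod_of_submod I) (hatHom NJ g) 0.
rewrite subr0 in E.
have p0 : (\pi_(lquot I) 0)%qT = 0 :> lquot I by exact: raddf0 (\pi_(Quotient.quot (zmod_of_submod I))).
split=> h.
  by rewrite -[X in is_true X]/(_ \in zmod_of_submod I) E; apply/eqP; rewrite -[LHS]/(\pi_(lquot I) _)%qT h.
apply: etrans p0; apply/eqP; by rewrite -[X in is_true X]E.
Qed.

(** The components of [phistar f] on the summands of M_in are the defects, so its kernel consists of
    the families commuting with all arrows. *)
Lemma homs_dim : has_dim (repHom M N) (\dim (homs M N)).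
Proof.
have homsE (f : hsp N M) : f \in homs M N <->
    forall l k (a : arr l k) x, f k (fd_map M a x) = fd_map N a (f l x).
  rewrite /homs memv_ker lfunE; split=> [/eqP e l k a x|h].
    have := phistar_in f (existT (fun l => arr l k) l a).
    rewrite e comp_lfun0l /defect => /esym/eqP; rewrite subr_eq0 => /eqP.
    by move/(congr1 (fun F : 'Hom(_, _) => F x)); rewrite !comp_lfunE.
  apply/eqP; apply: dvsum_ext => k; apply: dvsum_hom_ext => a.
  rewrite phistar_in comp_lfun0l /defect; apply/eqP; rewrite subr_eq0; apply/eqP.
  by apply/lfunP => x; rewrite !comp_lfunE h.
have mem (f : subvs_of (homs M N)) :
    (fun i => vsval f i : M i -> N i) \in @hom_pred K Q M N.
  apply/asboolP; split=> [i|i j a x]; first exact: linearP.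
  by have /homsE := subvsP f; apply.
pose p f : repHom M N := RepHom (mem f).
have pL : linear p.
  move=> c f g; apply: repHom_ext => i x /=.
  rewrite [LHS]/((c *: vsval f i + vsval g i) x) [RHS]/(c *: vsval f i x + vsval g i x).
  by rewrite [LHS]add_lfunE scale_lfunE.
rewrite -dim_subvs; apply: (has_dim_bij (p := linear_pack pL)) => [h|f g e].
  have /asboolP[hL hC] := hom_valP h.
  pose f : hsp N M := fun k => linfun (fun x : M k => hom_val h x : N k).
  have fE k (x : M k) : f k x = hom_val h x by rewrite (linfunE (hL k)).
  have fh : f \in homs M N by apply/homsE => l k a x; rewrite !fE; apply: hC.
  exists (vsproj (homs M N) f); apply: repHom_ext => i x.
  by rewrite [LHS]/(vsval (vsproj (homs M N) f) i x) vsprojK //; exact: fE.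
apply: subvs_inj; apply: dvsum_ext => k; apply/lfunP => x.
exact: (congr1 (fun h : repHom M N => hom_val h x) e).
Qed.

End Cokernel.

(** * The dual representation over the opposite quiver *)

Section Opposite.
Variables (K : fieldType) (Q : quiver) (S : potential K Q) (M : fdrep K Q).
Implicit Types (i j k l s : Q).
Hypothesis nl : loopless Q.

Local Notation Qop := (op_quiver Q).

Lemma loopless_op : loopless Qop.
Proof. by move=> i a; apply: (nl a). Qed.

Lemma msupp_sum_op (V : lmodType K) (F : Defs.cycle_path Qop -> V) :
  \sum_(c <- msupp (op_potential S)) (op_potential S)@_c *: F c =
  \sum_(c <- msupp S) S@_c *: F (mkcycle (Defs.prev (tagged c))).
Proof.
pose H := linear_pack (msupp_sum_linear F).
rewrite -[LHS]/(H (op_potential S)) /op_potential linear_sum.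
by apply: eq_bigr => c _; rewrite [LHS]msupp_sumU.
Qed.

Lemma path_act_dual j i (p : qpath j i) (xi : 'Hom(M i, K^o)) :
  path_act (dual_rep M) (Defs.prev p) xi = (xi \o path_act M p)%VF.
Proof.
elim: p xi => [|l i' a p IH] xi /=; first by rewrite id_lfunE comp_lfun1r.
rewrite path_act_pcat /= comp_lfun1r comp_lfunE.
rewrite (linfunE (f := fun f : 'Hom(M i', K^o) => (f \o fd_map M a)%VF)); last first.
  by move=> c f g; rewrite comp_lfunDl comp_lfunZl.
by rewrite IH comp_lfunA.
Qed.

(** Deleting a leading [b] from d_a S^op means, before reversal, deleting a final [b] from d_a S;
    [cyc_lead_trail] identifies the result with d_{ba} S, and reversed paths act by transposes. *)
Lemma act_dual l k i (b : arr k i) (a : arr l k) (xi : 'Hom(M l, K^o)) :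
  act (dual_rep M) (@cyc_deriv2 K Qop (op_potential S) i k l a b) xi =
  (xi \o act M (cyc_deriv2 S b a))%VF.
Proof.
rewrite (act_cyc_deriv2 _ loopless_op) (act_cyc_deriv2 _ nl).
rewrite (msupp_sum_op (fun c => \sum_(x <- occ _ (tagged c))
  \sum_(y <- occ _ (pcat x.1 x.2) | plen y.2 == 0%N) path_act (dual_rep M) y.1)).
rewrite sum_lfunE comp_lfun_sumr; apply: eq_bigr => c _.
rewrite scale_lfunE -comp_lfunZr; congr (_ *: _).
rewrite [tagged _]/= (occ_prev a (tagged c) (fun x =>
  \sum_(y <- occ _ (pcat x.1 x.2) | plen y.2 == 0%N) path_act (dual_rep M) y.1)).
transitivity (\sum_(x <- occ a (tagged c))
    \sum_(y <- occ b (pcat x.1 x.2) | plen y.1 == 0%N) (xi \o path_act M y.2)%VF).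
  rewrite sum_lfunE; apply: eq_bigr => x _ /=.
  rewrite -prev_pcat big_mkcond (occ_prev b (pcat x.1 x.2) (fun y =>
    if plen y.2 == 0%N then path_act (dual_rep M) y.1 else 0)) /= sum_lfunE.
  rewrite [RHS]big_mkcond; apply: eq_bigr => y _; rewrite plen_prev.
  by case: ifP => _; rewrite ?path_act_dual // [LHS]zero_lfunE.
rewrite -(cyc_lead_trail b a (tagged c) (fun p => xi \o path_act M p)%VF).
by rewrite comp_lfun_sumr; apply: eq_bigr => x _; rewrite comp_lfun_sumr.
Qed.

End Opposite.

Lemma gammaE (K : fieldType) (Q : quiver) (S : potential K Q) (M : fdrep K Q) (k : Q)
    (x : M_out M k) (a : {l : Q & arr l k}) :
  gamma M S k x a =
  \sum_(b : {i : Q & arr k i}) act M (cyc_deriv2 S (tagged b) (tagged a)) (x b).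
Proof.
rewrite /gamma sum_lfunE dvsum_sumE (bigD1 a) //= [X in _ + X]big1 ?addr0; last first.
  move=> a' ne; rewrite sum_lfunE dvsum_sumE big1 // => b _.
  by rewrite !comp_lfunE dvsum_inE dfwith_out.
rewrite sum_lfunE dvsum_sumE; apply: eq_bigr => b _.
by rewrite !comp_lfunE dvsum_inE dfwith_in dvsum_prE.
Qed.

(** Restricting forms to the summands identifies the dual of M_in(k) with the space M_out(k) of the
    dual representation. There gamma becomes xi |-> xi gamma_k, whose kernel is the annihilator of
    im gamma_k. *)
Lemma dim_ker_gamma_dual (K : fieldType) (Q : quiver) (nl : loopless Q)
    (S : potential K Q) (M : fdrep K Q) (k : Q) :
  \dim (lker (gamma (dual_rep M) (op_potential S) k)) =
  (\dim {:M_in M k} - \dim (limg (gamma M S k)))%N.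
Proof.
pose V := fun a : {l : Q & arr l k} => M (tag a).
pose D (xi : 'Hom(M_in M k, K^o)) : M_out (dual_rep M) k :=
  fun a => (xi \o dvsum_in V a)%VF.
have DL : linear D.
  move=> c f g; apply: dvsum_ext => a.
  rewrite [RHS]/(c *: (f \o dvsum_in V a)%VF + (g \o dvsum_in V a)%VF).
  by rewrite comp_lfunZl; exact: comp_lfunDl.
have DI : lker (linfun D) == 0%VS.
  apply/lker0P => f g; rewrite !(linfunE DL) => e; apply: dvsum_hom_ext => a.
  exact: (congr1 (fun x : M_out (dual_rep M) k => x a) e).
have DS y : exists xi, D xi = y.
  exists (\sum_a ((y a : 'Hom(M (tag a), K^o)) \o dvsum_pr V a))%VF.
  by apply: dvsum_ext => a; exact: (@dvsum_hom_in K _ V K^o (fun a => y a : 'Hom(V a, K^o)) a).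
pose G := (gamma (dual_rep M) (op_potential S) k \o linfun D)%VF.
have -> : \dim (lker (gamma (dual_rep M) (op_potential S) k)) = \dim (lker G).
  rewrite -(limg_dim_eq (f := linfun D) (U := lker G)); last first.
    by rewrite (eqP DI) capv0.
  congr (\dim _); apply/vspaceP => y; apply/idP/memv_imgP => [|[xi h ->]].
    have [xi <-] := DS y; exists xi; rewrite ?(linfunE DL) //.
    by rewrite memv_ker comp_lfunE (linfunE DL) -memv_ker.
  by move: h; rewrite !memv_ker comp_lfunE.
apply: dim_annihilator => xi; rewrite memv_ker comp_lfunE (linfunE DL).
have E (b : {i : Q & arr k i}) :
    gamma (dual_rep M) (op_potential S) k (D xi) b =
    (xi \o gamma M S k \o dvsum_in _ b)%VF.
  rewrite gammaE -comp_lfunA gamma_in comp_lfun_sumr; apply: eq_bigr => a _.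
  by rewrite [LHS]act_dual // comp_lfunA.
apply/eqP/eqP => e.
  by apply: dvsum_hom_ext => b; rewrite -E e comp_lfun0l.
by apply: dvsum_ext => b; rewrite E e comp_lfun0l.
Qed.

(** * The dimension formula *)

Theorem Eproj_dim (K : fieldType) (Q : quiver) (nl : loopless Q)
  (S : potential K Q) (n : nat)
  (Sn : forall (j i : Q) (x : PA K j i),
     ideal_exp (@arrow_ideal K Q) n x -> jacobian_ideal S x)
  (M N : decrep K Q) (MS : is_QPrep S M) (NS : is_QPrep S N)
  (spl : splitting S (dec_rep M)) :
  exists2 d, has_dim (Eproj_space N spl) d & d%:Z = Eproj S M N.
Proof.
have hV : has_dim (dsum (fun i => 'Hom(dec_sp M i, dec_rep N i) : lmodType K))
    (\dim {:hsp (dec_rep N) (dec_sp M)}).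
  by apply: (@has_dim_bij K (hsp (dec_rep N) (dec_sp M)) _ idfun) => // x; exists x.
have hd := has_dim_prod (coker_dim NS Sn spl) hV.
eexists; first exact: hd.
rewrite /Eproj (vdimE (homs_dim (dec_rep M) (dec_rep N))).
have tr := dim_trace nl MS NS Sn spl.
have le : (\dim (trace (dec_rep N) spl) <=
    \dim {:hsp (dec_rep N) (sub_fam (U1 spl))})%N by rewrite dimvS ?subvf.
rewrite PoszD -subzn //.
have -> : (\dim (homs (dec_rep M) (dec_rep N)))%:Z =
    (\dim {:hsp (dec_rep N) (sub_fam (M0 spl))})%:Z - (\dim (trace (dec_rep N) spl))%:Z.
  by rewrite -tr PoszD addrAC subrr add0r.
(* The dimension of [trace] is now subtracted on both sides and cancels; the rest is compared vertex
   by vertex. *)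
rewrite addrAC [RHS]addrAC; congr (_ - _).
rewrite !dim_hsp -!PoszD -big_split !(big_morph Posz PoszD (erefl _)) -big_split.
apply: eq_bigr => k _ /=.
rewrite /g_vec dim_ker_gamma_dual // dim_Hom [\dim {:K^o}]dimvf [dim _]/= muln1.
rewrite !dim_subvs.
have e1 := dim_direct_sum (U1P spl k).
have e2 := dim_direct_sum (M0P spl k).
have e3 := limg_ker_dim (alpha (dec_rep M) k) fullv; rewrite capfv in e3.
rewrite -e3 -e1 -e2.
set a := \dim (limg (gamma _ _ _)); set b := \dim (U1 _ _).
set c := \dim (M0 _ _); set d := \dim (limg (alpha _ _)).
set v := \dim {:dec_sp M k}; set m := \dim _.
(* Here dim M_in(k) = a + b + d and dim M(k) = c + d, so g_k of the dual is (b + d) - (c + d) + v =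
   b - c + v: the rank [d] of alpha_k cancels. *)
have -> : (a + b + d - a = b + d)%N by rewrite -addnA addKn.
rewrite !PoszD !PoszM; ring.
Qed.

Local Open Scope classical_set_scope.
Local Open Scope ring_scope.

Theorem theorem10p5 (R : realType) (Q : quiver)
  (Q_loopless : loopless Q) (Q_no_2cycles : no_2cycles Q)
  (S : potential R[i] Q) (S_potential : is_potential S)
  (J0_power : exists n : nat, forall j i : Q,
     @ideal_exp R[i] Q (@arrow_ideal R[i] Q) n j i `<=` @jacobian_ideal R[i] Q S j i)
  (M N : decrep R[i] Q) (M_QPrep : is_QPrep S M) (N_QPrep : is_QPrep S N)
  (spl : splitting S (dec_rep M)) :
  [/\ findim (Eproj_space N spl),
      (vdim (Eproj_space N spl))%:Z = Eproj S M N &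
      Eproj S M N =
        (vdim (repHom (dec_rep M) (dec_rep N)))%:Z +
        \sum_(k : Q) g_vec (op_potential S) (dual_decrep M) k
                     * (\dim {:dec_rep N k})%:Z].
Proof.
have [n Sn] := J0_power.
have [d hd e] := Eproj_dim Q_loopless Sn M_QPrep N_QPrep spl.
by split=> //; [exists d | rewrite (vdimE hd)].
Qed.
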